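(* Let $\Gamma\colon\mathbb{R}^d\to\mathbb{R}$ satisfy Assumption A (see context). Assume moreover that $\Gamma$ has a unique minimizer $x^\star$, with $\Gamma(x^\star)=0$ and $\nabla^2\Gamma(x^\star)>0$ (positive definite). Let $\{X_i:i\ge1\}$ be i.i.d. with the Gibbs distribution $\pi_\varrho$ at temperature $\varrho>0$, and let $G_i=\Gamma(X_i)$. Then the common CDF of the $G_i$ is $$F_\varrho(x)=\frac1{Z_\varrho}\int_{A_x}\exp\{-\varrho^{-1}\Gamma(y)\}\,dy,\qquad A_x=\{y:\Gamma(y)\le x\}.$$ Consequently, for each fixed $\varrho>0$ there is a constant $c_\varrho$ such that $$F_\varrho(x)\sim c_\varrho\,x^{d/2},\qquad x\downarrow0.$$ Moreover, $$c_\varrho\sim\frac{1}{\mathrm{Gamma}(d/2+1)\,\varrho^{d/2}},\qquad\varrho\downarrow0,$$ where $\mathrm{Gamma}(\cdot)$ denotes the Gamma function.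
   Context: Notation: $\Gamma^\star=\min_x\Gamma(x)$. For $\varrho>0$ the Gibbs measure is $\pi_\varrho(dx)=Z_\varrho^{-1}e^{-\Gamma(x)/\varrho}dx$ with $Z_\varrho=\int e^{-\Gamma(x)/\varrho}dx$. $f\sim g$ means $f/g\to1$. Assumption A on $\Gamma\colon\mathbb{R}^d\to\mathbb{R}$: (i) $\Gamma$ is $C^2$. (ii) $\Gamma$ is coercive, $\lim_{\|x\|\to\infty}\Gamma(x)/\log(1+\|x\|)=\lim_{\|x\|\to\infty}\|\nabla\Gamma(x)\|=\infty$, and $\sup_x\|\nabla^2\Gamma(x)\|<\infty$. (iii) There is a closed and bounded set $\mathcal{S}\subset\mathbb{R}^d$, equal to the closure of its interior, such that $\eta:=\inf_{x\in\mathcal{S}^c}[\Gamma(x)-\Gamma^\star]>0$, and there are positive constants $\mu_{\mathcal{S}},c_{\mathcal{S}}$ such that any solution of $\frac{d}{dt}x_t=-\nabla\Gamma(x_t)$ with $x_0\in\mathcal{S}$ satisfies $\Gamma(x_t)-\Gamma^\star\le c_{\mathcal{S}}e^{-\mu_{\mathcal{S}}t}$ for $t\ge0$. *)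

(* Defs.v *)
From HB Require Import structures.
From mathcomp Require Import all_boot all_order all_algebra.
From mathcomp Require Import all_classical all_reals all_analysis.

Set Implicit Arguments.
Unset Strict Implicit.
Unset Printing Implicit Defensive.

Import Order.TTheory GRing.Theory Num.Theory.
Import numFieldNormedType.Exports.

Local Open Scope classical_set_scope.
Local Open Scope ring_scope.

Definition measure_rV_display (d : measure_display) : measure_display.
Proof. exact: d. Qed.

(* As for [n.-tuple T] in the library, row vectors carry the product
   sigma-algebra, generated by the coordinates; for the topology of ['rV[R]_n]
   this is the Borel sigma-algebra. *)
Section measurable_rV.
Context {R : realType} {n : nat}.

Let coors : 'I_n -> 'rV[R]_n -> R := fun i v => v ord0 i.

Let rV_set0 : g_sigma_preimage coors set0.
Proof. exact: sigma_algebra0. Qed.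

Let rV_setC A : g_sigma_preimage coors A -> g_sigma_preimage coors (~` A).
Proof. exact: sigma_algebraC. Qed.

Let rV_bigcup (F : (set 'rV[R]_n)^nat) :
  (forall i, g_sigma_preimage coors (F i)) ->
  g_sigma_preimage coors (\bigcup_i (F i)).
Proof. exact: sigma_algebra_bigcup. Qed.

HB.instance Definition _ := @isMeasurable.Build
  (measure_rV_display default_measure_display)
  'rV[R]_n (g_sigma_preimage coors) rV_set0 rV_setC rV_bigcup.

End measurable_rV.

Section measurable_fun_rV.
Context {R : realType}.

Lemma measurable_coord n (i : 'I_n) :
  measurable_fun [set: 'rV[R]_n] (fun v : 'rV[R]_n => v ord0 i).
Proof.
move=> _ Y mY; rewrite setTI; apply: sub_sigma_algebra => /=.
rewrite -bigcup_seq/=; exists i => /=; first by rewrite mem_index_enum.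
by exists Y => //; rewrite setTI.
Qed.

Lemma measurable_fun_coordP d (T : measurableType d) n (f : T -> 'rV[R]_n) :
  (forall i, measurable_fun [set: T] (fun x => f x ord0 i)) ->
  measurable_fun [set: T] f.
Proof.
move=> mf _ Y mY; rewrite setTI.
apply: (@smallest_sub _ (sigma_algebra setT)
  (\big[setU/set0]_(i < n) preimage_set_system setT
      (fun v : 'rV[R]_n => v ord0 i) measurable)
  [set A | measurable (f @^-1` A)]) => //.
- split => [|A|F] /=.
  + by rewrite preimage_set0.
  + by move=> mA; rewrite setTD preimage_setC; exact: measurableC.
  + by move=> mF; rewrite preimage_bigcup; exact: bigcup_measurable.
- move=> A; rewrite -bigcup_seq => -[i _] [B mB <-] /=.
  by rewrite setTI -(setTI (_ @^-1` _)); exact: mf.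
Qed.

(* [rVcons] and [rVuncons] identify R * R^n with R^(1 + n) = R^n.+1. *)
Definition rVcons n (p : measurableTypeR R * 'rV[R]_n) : 'rV[R]_n.+1 :=
  row_mx (p.1%:M : 'rV_1) p.2.

Definition rVuncons n (v : 'rV[R]_n.+1) : measurableTypeR R * 'rV[R]_n :=
  (v ord0 ord0, \row_i v ord0 (lift ord0 i)).

Lemma rVconsK n : cancel (@rVcons n) (@rVuncons n).
Proof.
move=> [x v]; rewrite /rVcons /rVuncons; congr pair.
  rewrite (_ : ord0 = lshift n ord0 :> 'I_(1 + n)); last exact/val_inj.
  by rewrite (@row_mxEl _ 1 1 n) mxE eqxx.
apply/rowP => i; rewrite mxE.
rewrite (_ : lift ord0 i = rshift 1 i :> 'I_(1 + n)); last exact/val_inj.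
by rewrite (@row_mxEr _ 1 1 n).
Qed.

Lemma measurable_rVcons n : measurable_fun setT (@rVcons n).
Proof.
apply: measurable_fun_coordP => i.
case: (unliftP ord0 i) => [j ->|->].
- rewrite (_ : (fun _ => _) = (fun v : 'rV[R]_n => v ord0 j) \o snd).
    by apply: measurableT_comp => //; exact: measurable_coord.
  apply/funext => p /=.
  by rewrite -[in RHS](rVconsK p) /= mxE.
- rewrite (_ : (fun _ => _) = fst)//; apply/funext => p /=.
  by rewrite -[in RHS](rVconsK p).
Qed.

Lemma measurable_rVuncons n : measurable_fun setT (@rVuncons n).
Proof.
apply/measurable_fun_pairP; split => /=; first exact: measurable_coord.
apply: measurable_fun_coordP => i /=.
rewrite (_ : (fun _ => _) = (fun v : 'rV[R]_n.+1 => v ord0 (lift ord0 i))).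
  exact: measurable_coord.
by apply/funext => v; rewrite /= mxE.
Qed.

End measurable_fun_rV.

Section lebesgue_rV.
Context {R : realType}.

Section step.
Context {n : nat} (mu : {sigma_finite_measure set 'rV[R]_n -> \bar R}).
Local Open Scope ereal_scope.

Definition lebesgue_rV_step : set 'rV[R]_n.+1 -> \bar R :=
  pushforward (@lebesgue_measure R \x mu) (@rVcons R n).

Let step_measurable (A : set 'rV[R]_n.+1) :
  measurable A -> measurable (@rVcons R n @^-1` A).
Proof. by move=> mA; rewrite -[X in measurable X]setTI; exact: measurable_rVcons. Qed.

Let step0 : lebesgue_rV_step set0 = 0.
Proof. by rewrite /lebesgue_rV_step /pushforward preimage_set0 measure0. Qed.

Let step_ge0 A : 0 <= lebesgue_rV_step A.
Proof. by rewrite /lebesgue_rV_step /pushforward measure_ge0. Qed.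

Let step_sigma_additive : semi_sigma_additive lebesgue_rV_step.
Proof.
move=> F mF tF mUF; rewrite /lebesgue_rV_step /pushforward preimage_bigcup.
apply: measure_semi_sigma_additive => [i||].
- exact: step_measurable.
- apply/trivIsetP => i j _ _ ij; rewrite -preimage_setI.
  by move/trivIsetP : tF => /(_ _ _ _ _ ij) ->//; rewrite preimage_set0.
- by rewrite -preimage_bigcup; exact: step_measurable.
Qed.

HB.instance Definition _ := isMeasure.Build _ _ _ lebesgue_rV_step
  step0 step_ge0 step_sigma_additive.

Let step_sigma_finite : sigma_finite setT lebesgue_rV_step.
Proof.
have /sigma_finiteP[F [FT ndF Foo]] := sigma_finiteT (@lebesgue_measure R).
have /sigma_finiteP[G [GT ndG Goo]] := sigma_finiteT mu.
exists (fun i => @rVuncons R n @^-1` (F i `*` G i)).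
  rewrite -preimage_bigcup (_ : \bigcup_i _ = setT) ?preimage_setT//.
  apply/seteqP; split=> // -[x y] _.
  have [i _ Fx] : (\bigcup_i F i) x by rewrite -FT.
  have [j _ Gy] : (\bigcup_i G i) y by rewrite -GT.
  exists (maxn i j) => //; split => /=.
    by move: x Fx; exact/subsetPset/ndF/leq_maxl.
  by move: y Gy; exact/subsetPset/ndG/leq_maxr.
move=> i; have [mF Fi] := Foo i; have [mG Gi] := Goo i; split.
  rewrite -[X in measurable X]setTI; apply: measurable_rVuncons => //.
  exact: measurableX.
rewrite /lebesgue_rV_step /pushforward -comp_preimage.
rewrite (_ : _ \o _ = id) ?preimage_id; last first.
  by apply/funext => p; exact: rVconsK.
by rewrite product_measure1E// lte_mul_pinfty// ge0_fin_numE.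
Qed.

HB.instance Definition _ := Measure_isSigmaFinite.Build _ _ _ lebesgue_rV_step
  step_sigma_finite.

End step.

Fixpoint lebesgue_rV n : {sigma_finite_measure set 'rV[R]_n -> \bar R} :=
  if n is m.+1 then lebesgue_rV_step (lebesgue_rV m)
  else [the {sigma_finite_measure set 'rV[R]_0 -> \bar R} of
        dirac (0 : 'rV[R]_0)].

End lebesgue_rV.

Section calculus.
Context {R : realType} {n : nat}.
Implicit Types (f : 'rV[R]_n -> R) (v x : 'rV[R]_n).

(* The library norm on row vectors is the max norm; this is the Euclidean one. *)
Definition enorm v : R := Num.sqrt (\sum_i v ord0 i ^+ 2).

Definition opnorm (A : 'M[R]_n) : R :=
  sup [set enorm (v *m A) | v in [set v | enorm v <= 1]].

Definition partial (i : 'I_n) f : 'rV[R]_n -> R := 'D_(delta_mx ord0 i) f.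

Definition grad f x : 'rV[R]_n := \row_i partial i f x.

Definition hess f x : 'M[R]_n := \matrix_(i, j) partial j (partial i f) x.

Definition has_continuous_partials f : Prop :=
  forall i : 'I_n, (forall x, derivable f x (delta_mx ord0 i)) /\
                   continuous (partial i f).

Definition C2 f : Prop :=
  has_continuous_partials f /\
  forall i : 'I_n, has_continuous_partials (partial i f).

Definition posdef (A : 'M[R]_n) : Prop :=
  forall v, v != 0 -> 0 < (v *m A *m v^T) ord0 ord0.

(* The filter of the limits "as the norm of x tends to infinity". *)
Definition at_infinity : set_system 'rV[R]_n :=
  filter_from [set: R] (fun M => [set x | M < enorm x]).

Definition is_minimizer f x : Prop := forall y, f x <= f y.

(* A minimum under [assumptionA]: [f] is then continuous and tends to +oo. *)
Definition min_value f : R := inf (range f).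

(* Solutions on [0, +oo[ of y' = - grad f y; no condition is put on the values
   of [y] at negative times. *)
Definition gradient_flow f (y : R -> 'rV[R]_n) : Prop :=
  {within `[0, +oo[, continuous y} /\
  forall t : R, 0 < t -> is_derive t 1 y (- grad f (y t)).

Definition assumptionA f : Prop :=
  [/\ C2 f,
      [/\ f x / ln (1 + enorm x) @[x --> at_infinity] --> +oo,
          enorm (grad f x) @[x --> at_infinity] --> +oo
        & has_ubound (range (fun x => opnorm (hess f x)))]
    & exists S : set 'rV[R]_n,
      [/\ closed S, bounded_set S, S = closure S°,
          0 < inf [set f x - min_value f | x in ~` S]
        & exists mu c : R, [/\ 0 < mu, 0 < c
            & forall y, gradient_flow f y -> S (y 0) ->
              forall t, 0 <= t ->
                f (y t) - min_value f <= c * expR (- mu * t)]]].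

End calculus.

Section gibbs.
Context {R : realType} {n : nat}.
Variables (f : 'rV[R]_n -> R) (rho : R).

Definition gibbs_weight (x : 'rV[R]_n) : R := expR (- f x / rho).

Definition gibbs_Z : R := \int[lebesgue_rV n]_x gibbs_weight x.

Definition gibbs (A : set 'rV[R]_n) : \bar R :=
  (gibbs_Z^-1%:E * \int[lebesgue_rV n]_(x in A) (gibbs_weight x)%:E)%E.

Definition gibbs_cdf (x : R) : R :=
  gibbs_Z^-1 * \int[lebesgue_rV n]_(y in [set y | f y <= x]) gibbs_weight y.

End gibbs.

Section iid.
Context {R : realType} {d d' : measure_display}.
Context {T : measurableType d} {U : measurableType d'} {P : probability T R}.
Implicit Type X : nat -> {RV P >-> U}.

Definition mutually_independent X : Prop :=
  forall (s : seq nat) (A : nat -> set U),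
    uniq s -> (forall i, measurable (A i)) ->
    P (\bigcap_(i in [set` s]) X i @^-1` A i) =
    (\prod_(i <- s) P (X i @^-1` A i))%E.

Definition iid_with_law (mu : set U -> \bar R) X : Prop :=
  mutually_independent X /\
  forall i A, measurable A -> distribution P (X i) A = mu A.

End iid.

Definition asymp {R : realType} (F : set_system R) (f g : R -> R) : Prop :=
  f x / g x @[x --> F] --> (1 : R).

Definition Gamma {R : realType} (a : R) : R :=
  \int[lebesgue_measure]_(t in `]0, +oo[) (t `^ (a - 1) * expR (- t)).

(* Main.v *)
Require Import Defs.
From HB Require Import structures.
From mathcomp Require Import all_boot all_order all_algebra.
From mathcomp Require Import all_classical all_reals all_analysis.
From mathcomp Require Import measurable_realfun lra ring zify.

Set Implicit Arguments.
Unset Strict Implicit.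
Unset Printing Implicit Defensive.

Import Order.TTheory GRing.Theory Num.Theory.
Import numFieldNormedType.Exports.

Local Open Scope classical_set_scope.
Local Open Scope ring_scope.

(** With H the Hessian at the minimizer and q v = v H v^T / 2, the second-order
    Taylor expansion gives (1 - e) q <= f (xstar + _) <= (1 + e) q near 0, and
    sublevel sets {f <= x} shrink to xstar as x -> 0, so that
    vol {f <= x} ~ V x^(n/2) with V = vol {q <= 1}, by homogeneity of Lebesgue
    measure.  On {f <= x} the Gibbs weight lies between e^(-x/rho) and 1, hence
    F_rho(x) ~ (V / Z_rho) x^(n/2).  For small rho, the layer-cake formula
    Z_rho = int_0^oo e^(-s) vol {f <= rho s} ds and dominated convergence give
    Z_rho / rho^(n/2) -> V int_0^oo e^(-s) s^(n/2) ds = V Gamma(n/2 + 1), so V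
    cancels in c_rho = V / Z_rho; neither the volume of the unit ball nor
    det H is ever computed. *)

(** * Second-order expansion at the minimizer *)

(** Two obstacles shape the development. The hypothesis [C2] speaks only of coordinate partial
    derivatives, so derivatives along arbitrary lines, their linearity in the direction and the
    Taylor formula are rebuilt from one-variable mean value theorems. And the limit of Z_rho needs
    more than local asymptotics: it needs a bound on vol {f <= x} for all x > 0. Coercivity supplies
    it. Since f outgrows every multiple of ln (1 + |y|), for each a > 0 the volume is at most C e^(a
    x) with C depending on a; this alone makes Z_rho finite at every temperature. Merged with the
    local behaviour into C x^(n/2) e^(a x), the bound scales like rho^(n/2) under x = rho s, which
    yields a dominating function independent of rho. *)

Section directional_calculus.
Context {R : realType} {n : nat}.
Implicit Types (h : 'rV[R]_n -> R) (x v w : 'rV[R]_n).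

(** Both sides are limits of one and the same difference quotient, up to simplifying [t *: 1 + 0];
    one-variable calculus thus applies along lines. *)
Lemma is_derive_line h x v (l : R) :
  is_derive x v h l <-> is_derive (0 : R) 1 (fun t : R => h (x + t *: v)) l.
Proof.
have E : (fun t : R => t^-1 *: (h (t *: v + x) - h x)) =
  (fun t : R => t^-1 *: (h (x + (t *: (1 : R) + 0) *: v) - h (x + (0 : R) *: v))).
  apply/funext => t; rewrite scale0r addr0 addr0.
  by rewrite [t *: (1 : R)]mulr1 [x + _]addrC.
by split => -[D <-]; split; rewrite ?/derivable ?/derive in D * => //=;
  move: D; rewrite E.
Qed.

Lemma is_derive_line_at h x v (t : R) (l : R) :
  is_derive (x + t *: v) v h l ->
  is_derive t 1 (fun t : R => h (x + t *: v)) l.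
Proof.
have E : (fun s : R => s^-1 *: (h (s *: v + (x + t *: v)) - h (x + t *: v))) =
  (fun s : R => s^-1 *: (h (x + (s *: (1 : R) + t) *: v) - h (x + t *: v))).
  apply/funext => s; rewrite [s *: (1 : R)]mulr1 scalerDl.
  by rewrite addrCA.
by move=> [D <-]; split; rewrite ?/derivable ?/derive in D * => //=;
  move: D; rewrite E.
Qed.

Lemma MVT_line h v x : (forall y, derivable h y v) ->
  exists2 t : R, 0 <= t <= 1 & h (x + v) - h x = 'D_v h (x + t *: v).
Proof.
move=> dh.
have dg (t : R) : is_derive t 1 (fun t => h (x + t *: v)) ('D_v h (x + t *: v)).
  exact/is_derive_line_at/derivableP.
have [|t] := @MVT_segment R (fun t => h (x + t *: v)) _ 0 1 ler01 (fun t _ => dg t).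
  apply: continuous_subspaceT => t.
  by apply/differentiable_continuous/derivable1_diffP; case: (dg t).
rewrite in_itv/= => t01; rewrite scale1r scale0r addr0 subr0 mulr1 => E.
by exists t.
Qed.

(** Fixing one direction makes the property additive: for a given [h], the directions satisfying it
    turn out to form a linear subspace, so basis vectors suffice. *)
Definition C1_along h v := (forall x, derivable h x v) /\ continuous ('D_v h).

Lemma C1_along0 h : C1_along h 0 /\ forall x, 'D_0 h x = 0.
Proof.
have D x : is_derive x 0 h 0 by exact: is_derive0.
have E : 'D_0 h = cst 0 by apply/funext => x; rewrite derive_val.
split; last by move=> x; rewrite derive_val.
by split => [x|]; [case: (D x)|rewrite E; exact: cst_continuous].
Qed.

(** Chain rule with inner map [t |-> a * t], so [a = 0] needs no separate case. *)
Lemma C1_alongZ h v (a : R) : C1_along h v ->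
  C1_along h (a *: v) /\ forall x, 'D_(a *: v) h x = a * 'D_v h x.
Proof.
move=> [dh ch].
have D x : is_derive x (a *: v) h (a * 'D_v h x).
  apply/is_derive_line.
  under eq_fun do rewrite scalerA mulrC.
  pose g := fun t : R => h (x + t *: v).
  have dg (t : R) : is_derive t 1 g ('D_v h (x + t *: v)).
    exact/is_derive_line_at/derivableP.
  have dm : is_derive (0 : R) 1 (fun t : R => a * t) a.
    by have := is_deriveZ a (is_derive_id (0 : R) 1); rewrite [a *: _]mulr1.
  have := @is_derive1_comp R g (fun t : R => a * t) 0 _ _ (dg _) dm.
  by rewrite mulr0 scale0r addr0 mulrC.
have E : 'D_(a *: v) h = a \*: 'D_v h by apply/funext => x; rewrite derive_val.
split; last by move=> x; rewrite derive_val.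
split=> [x|]; first by case: (D x).
by rewrite E => x; exact: (@cvgZl_tmp R R^o _ _ _ a ('D_v h) _ (ch x)).
Qed.

(* The increment along [t *: w] starts at the moving point [x + t *: v]; the mean
   value theorem and continuity of ['D_w h] bring it back to [x]. *)
Lemma C1_alongD h v w : C1_along h v -> C1_along h w ->
  C1_along h (v + w) /\ forall x, 'D_(v + w) h x = 'D_v h x + 'D_w h x.
Proof.
move=> [dv cv] Cw; have [dw cw] := Cw.
have D x : is_derive x (v + w) h ('D_v h x + 'D_w h x).
  have K : (fun t : R => t^-1 *: (h (t *: (v + w) + x) - h x)) @ 0^' -->
      ('D_v h x + 'D_w h x : R).
    have -> : (fun t : R => t^-1 *: (h (t *: (v + w) + x) - h x)) =
        (fun t : R => t^-1 *: (h (t *: v + x) - h x)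
           + t^-1 *: (h ((t *: v + x) + t *: w) - h (t *: v + x))).
      apply/funext => t; rewrite -scalerDr; congr (_ *: _).
      by rewrite scalerDr -addrA [t *: w + x]addrC addrA; lra.
    apply: cvgD; first by case: (derivableP (dv x)).
    apply/cvgrPdist_lt => e e0.
    have /cvgrPdist_lt/(_ _ e0)/nbhs_ballP[r /= r0 rP] := cw x.
    (* The intermediate point is at distance at most [|t| * (|v| + |w|)] from [x]; the extra 1 makes
       the divisor positive when both directions vanish. *)
    have vw0 : 0 < `|v| + `|w| + 1 by rewrite ltr_wpDl// addr_ge0.
    near=> t.
    have t0 : t != 0 by near: t; exact: nbhs_dnbhs_neq.
    have [Cz Ez] := C1_alongZ t Cw.
    have [s /andP[s0 s1] ->] := MVT_line (t *: v + x) Cz.1.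
    rewrite Ez [_ *: _]mulrA mulVf// mul1r; apply: rP.
    rewrite -ball_normE/=.
    rewrite (_ : x - _ = - (t *: (v + s *: w))); last first.
      by apply/rowP => i; rewrite !mxE; ring.
    rewrite normrN normrZ.
    apply: (@le_lt_trans _ _ (`|t| * (`|v| + `|w| + 1))).
      apply: ler_wpM2l => //; apply: (le_trans (ler_normD _ _)).
      rewrite -addrA lerD2l normrZ ger0_norm//.
      apply: (@le_trans _ _ (1 * `|w|)); first exact: ler_wpM2r.
      by rewrite mul1r lerDl.
    rewrite -ltr_pdivlMr//; near: t.
    have := @dnbhs0_lt R R (r / (`|v| + `|w| + 1)).
    by apply; rewrite divr_gt0.
  split; first by apply/cvg_ex; exists ('D_v h x + 'D_w h x).
  exact/cvg_lim.
have E : 'D_(v + w) h = 'D_v h \+ 'D_w h.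
  by apply/funext => x; rewrite derive_val.
split; last by move=> x; rewrite derive_val.
split=> [x|]; first by case: (D x).
by rewrite E => x; exact: (@cvgD R R^o _ _ _ ('D_v h) ('D_w h) _ _ (cv x) (cw x)).
Unshelve. all: by end_near. Qed.

(** Write [v] in the standard basis and add the terms one index at a time, by closure under zero,
    scaling and addition. *)
Lemma C1_along_partials h v : has_continuous_partials h ->
  C1_along h v /\ forall x, 'D_v h x = \sum_i v ord0 i * partial i h x.
Proof.
move=> Ch.
suff K (r : seq 'I_n) :
    C1_along h (\sum_(i <- r) v ord0 i *: delta_mx ord0 i) /\
    forall x, 'D_(\sum_(i <- r) v ord0 i *: delta_mx ord0 i) h x =
              \sum_(i <- r) v ord0 i * partial i h x.
  by have := K (index_enum 'I_n); rewrite -row_sum_delta.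
elim: r => [|i r [Cr Er]].
  by rewrite big_nil; have [C E] := C1_along0 h; split; [exact: C|move=> x; by rewrite E big_nil].
have [dh ch] := Ch i.
have [Ci Ei] := @C1_alongZ h (delta_mx ord0 i) (v ord0 i) (conj dh ch).
have [C E] := C1_alongD Ci Cr; rewrite big_cons; split; first exact: C.
by move=> x; rewrite E Er Ei big_cons.
Qed.

Lemma coord_le_norm v i : `|v ord0 i| <= `|v|.
Proof.
rewrite -[leRHS]/(mx_norm v) mx_normrE.
exact: (@le_bigmax _ _ _ 0 (fun p => `|v p.1 p.2|) (ord0, i)).
Qed.

Lemma continuous_rVP h : continuous h <-> forall x (e : R), 0 < e ->
  exists2 r, 0 < r & forall y, `|x - y| < r -> `|h x - h y| < e.
Proof.
split=> [ch x e e0|ch].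
  have /(@cvgrPdist_lt _ _ _ _ (nbhs_filter x))/(_ _ e0) := ch x.
  by move=> /nbhs_ballP[r /= r0 rP]; exists r => // y xy; apply: rP; rewrite -ball_normE.
suff K (x : 'rV[R]_n) : h y @[y --> x] --> h x by move=> x; exact: K.
apply/(@cvgrPdist_lt _ _ _ _ (nbhs_filter x)) => e e0.
have [r r0 rP] := ch x e e0.
by apply/nbhs_ballP; exists r => // y; rewrite -ball_normE => /rP.
Qed.

Lemma continuous_common_radius (I : finType) (F : I -> 'rV[R]_n -> R) x (e : R) :
  (forall i, continuous (F i)) -> 0 < e ->
  exists2 r, 0 < r & forall y, `|x - y| < r -> forall i, `|F i x - F i y| < e.
Proof.
move=> cF e0.
have rP i : exists2 r, 0 < r & forall y, `|x - y| < r -> `|F i x - F i y| < e.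
  exact: (continuous_rVP (F i)).1.
pose r i := sval (cid2 (rP i)).
(* The starting value 1 keeps the radius positive when [I] is empty. *)
exists (\big[Order.min/1]_i r i) => [|y xy i].
  by apply/lt_bigmin => //= i _; rewrite /r; case: cid2.
have : \big[Order.min/1]_i r i <= r i by exact: bigmin_le.
by rewrite /r; case: cid2 => /= ri ri0 + r0ri; apply; exact: lt_le_trans r0ri.
Qed.

(** Near [x] each partial derivative is at most its modulus at [x] plus 1, so the mean value theorem
    makes [h] Lipschitz at [x] with constant [M]; the last 1 in [M] ensures [M > 0]. *)
Lemma has_continuous_partials_continuous h :
  has_continuous_partials h -> continuous h.
Proof.
move=> Ch; apply/continuous_rVP => x e e0.
pose M : R := \sum_i (`|partial i h x| + 1) + 1.
have M0 : 0 < M by rewrite ltr_wpDl// sumr_ge0// => i _; rewrite addr_ge0.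
have [r r0 rP] := continuous_common_radius x (fun i => (Ch i).2) ltr01.
exists (Order.min r (e / M)) => [|y]; first by rewrite lt_min r0 divr_gt0.
rewrite lt_min => /andP[xyr xye].
have [C E] := C1_along_partials (y - x) Ch.
have [t /andP[t0 t1]] := MVT_line x C.1.
rewrite [x + _]addrC subrK E distrC => ->.
apply: (@le_lt_trans _ _ (`|x - y| * M)); last first.
  by rewrite -ltr_pdivlMr.
apply: (le_trans (ler_norm_sum _ _ _)).
apply: (@le_trans _ _ (`|x - y| * \sum_i (`|partial i h x| + 1))); last first.
  by rewrite ler_wpM2l// lerDl.
rewrite mulr_sumr ler_sum// => i _; rewrite normrM ler_pM//.
  by rewrite distrC; exact: coord_le_norm.
rewrite -lerBlDl (le_trans (lerB_dist _ _))// distrC ltW//.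
apply: rP; rewrite opprD addNKr normrN normrZ ger0_norm//.
by apply: le_lt_trans xyr; rewrite distrC ler_piMl.
Qed.

(** [phi] is [g] minus a quadratic chosen so that [phi 0 = phi 1]. Rolle gives [c > 0] with
    [dg c - dg 0 = 2 * k * c]; the mean value theorem for [dg] on [[0, c]] rewrites the left side as
    [ddg t * c], and [c] cancels. *)
Lemma taylor2 (g dg ddg : R -> R) :
  (forall t : R, is_derive t 1 g (dg t)) ->
  (forall t : R, is_derive t 1 dg (ddg t)) ->
  exists2 t, 0 <= t <= 1 & g 1 = g 0 + dg 0 + ddg t / 2.
Proof.
move=> Dg Ddg.
pose k := g 1 - g 0 - dg 0.
pose phi (t : R) := g t - dg 0 * t - k * t ^+ 2.
have Dphi (t : R) : is_derive t 1 phi (dg t - dg 0 - k * (2 * t)).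
  have := is_deriveB (is_deriveB (Dg t) (is_deriveZ (dg 0) (is_derive_id t 1)))
    (is_deriveZ k (is_deriveX 2 (is_derive_id t 1))).
  rewrite [X in is_derive _ _ _ X -> _](_ : _ = dg t - dg 0 - k * (2 * t))//.
  by rewrite [dg 0 *: _]mulr1 [_ *: (1 : R)]mulr1 expr1.
have cont (F : R -> R) (dF : R -> R) : (forall t : R, is_derive t 1 F (dF t)) ->
    continuous F.
  move=> DF t.
  by apply/differentiable_continuous/derivable1_diffP; case: (DF t).
have [|||c] := @Rolle R phi 0 1 ltr01.
- by move=> t _; case: (Dphi t).
- exact/continuous_subspaceT/cont.
- by rewrite /phi /k; lra.
rewrite in_itv/= => /andP[c0 c1] /@derive_val; rewrite (@derive_val _ _ _ _ _ _ _ (Dphi c)) => Ec.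
have [|t] := @MVT_segment R dg ddg 0 c (ltW c0) (fun t _ => Ddg t).
  exact/continuous_subspaceT/cont.
rewrite in_itv/= => /andP[t0 tc] Et; exists t; first by rewrite t0 (le_trans tc (ltW c1)).
have : (ddg t - k * 2) * c = 0 by rewrite mulrBl -mulrA -{1}(subr0 c) -Et.
by move/eqP; rewrite mulf_eq0 (gt_eqF c0) orbF /k => /eqP; lra.
Qed.

Lemma taylor2_rV h x v : C2 h ->
  exists2 t : R, 0 <= t <= 1 & h (x + v) = h x +
    \sum_i v ord0 i * partial i h x +
    (v *m hess h (x + t *: v) *m v^T) ord0 ord0 / 2.
Proof.
move=> [C1h C2h].
have [[dh _] Dh] := C1_along_partials v C1h.
pose ddg (t : R) := \sum_i v ord0 i * 'D_v (partial i h) (x + t *: v).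
have [t||t t01 E] := @taylor2 (fun t => h (x + t *: v))
  (fun t => 'D_v h (x + t *: v)) ddg.
- exact/is_derive_line_at/derivableP.
- move=> t; under eq_fun do rewrite Dh.
  have D i : is_derive t 1 (v ord0 i \*: (fun t => partial i h (x + t *: v)))
      (v ord0 i *: 'D_v (partial i h) (x + t *: v)).
    apply/is_deriveZ/is_derive_line_at/derivableP.
    by have [[]] := C1_along_partials v (C2h i).
  by have := is_derive_sum D; rewrite fct_sumE.
exists t => //.
move: E; rewrite scale1r scale0r addr0 Dh => ->; congr (_ + _ / 2).
rewrite /ddg mxE.
under [RHS]eq_bigr do rewrite mxE mulr_suml.
rewrite exchange_big/=; apply: eq_bigr => i _.
have [_ ->] := C1_along_partials v (C2h i).
rewrite mulr_sumr; apply: eq_bigr => j _.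
by rewrite !mxE; ring.
Qed.

(** * Quadratic forms and the Hessian at the minimizer *)

Definition quad_form (H : 'M[R]_n) v : R := (v *m H *m v^T) ord0 ord0 / 2.

Lemma quad_formE (H : 'M[R]_n) v :
  quad_form H v = (\sum_i \sum_j v ord0 i * v ord0 j * H i j) / 2.
Proof.
rewrite /quad_form mxE exchange_big/=; congr (_ / 2).
apply: eq_bigr => j _; rewrite !mxE mulr_suml; apply: eq_bigr => i _.
by ring.
Qed.

Lemma quad_formZ (H : 'M[R]_n) (a : R) v :
  quad_form H (a *: v) = a ^+ 2 * quad_form H v.
Proof.
rewrite !quad_formE mulrA mulr_sumr; congr (_ / 2); apply: eq_bigr => i _.
by rewrite mulr_sumr; apply: eq_bigr => j _; rewrite !mxE; ring.
Qed.

Lemma quad_formB (H K : 'M[R]_n) v :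
  quad_form (H - K) v = quad_form H v - quad_form K v.
Proof. by rewrite /quad_form mulmxBr mulmxBl !mxE mulrBl. Qed.

Lemma quad_form_continuous (H : 'M[R]_n) : continuous (quad_form H).
Proof.
suff K (x : 'rV[R]_n) : quad_form H y @[y --> x] --> quad_form H x by move=> x; exact: K.
rewrite (_ : quad_form H = fun y => (\sum_i \sum_j y ord0 i * y ord0 j * H i j) / 2); last first.
  by apply/funext => y; rewrite quad_formE.
have FF := nbhs_filter x.
apply: (@cvgMr_tmp R _ _ FF); apply: (@cvg_big R _ _ _ _ _ _ _ _ _ _ FF); first exact: add_continuous.
move=> i _; apply: (@cvg_big R _ _ _ _ _ _ _ _ _ _ FF); first exact: add_continuous.
move=> j _; apply: (@cvgMr_tmp R _ _ FF).
by apply: (@cvgM R _ _ FF); exact: coord_continuous.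
Qed.

Lemma quad_form_le (H : 'M[R]_n) (e : R) v : (forall i j, `|H i j| <= e) ->
  `|quad_form H v| <= (n * n)%:R * e / 2 * `|v| ^+ 2.
Proof.
move=> He.
rewrite quad_formE normrM (@ger0_norm _ 2^-1) ?invr_ge0//.
rewrite mulrAC ler_wpM2r ?invr_ge0//.
have -> : (n * n)%:R * e * `|v| ^+ 2 = \sum_(i < n) \sum_(j < n) `|v| * `|v| * e.
  rewrite !sumr_const !card_ord -mulrnA -[RHS]mulr_natl -mulrA expr2.
  by rewrite [e * _]mulrC.
apply: (le_trans (ler_norm_sum _ _ _)); apply: ler_sum => i _.
apply: (le_trans (ler_norm_sum _ _ _)); apply: ler_sum => j _.
by rewrite !normrM !ler_pM// ?mulr_ge0//; exact: coord_le_norm.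
Qed.

(** [lam] is the minimum of the form on the compact unit sphere of the max norm; homogeneity of
    degree 2 extends the bound to all vectors. *)
Lemma posdef_ge (H : 'M[R]_n) : posdef H ->
  exists2 lam, 0 < lam & forall v, lam * `|v| ^+ 2 <= quad_form H v.
Proof.
move=> Hpos.
pose S := [set v : 'rV[R]_n | `|v| = 1].
have Hnz v : v != 0 -> S (`|v|^-1 *: v).
  move=> v0; rewrite /S/= normrZ ger0_norm ?invr_ge0// mulVf//.
  by rewrite normr_eq0.
have q0 : quad_form H 0 = 0 by rewrite /quad_form mul0mx mul0mx mxE mul0r.
(* The sphere is empty only if every vector is zero ([n = 0]); any positive [lam] then works. *)
have [S0|/nonemptyPn/seteqP[+ _]] := pselect (S !=set0); last first.
  move=> S0; exists 1 => // v; have [->|/Hnz/S0//] := eqVneq v 0.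
  by rewrite normr0 expr0n mulr0 q0.
have cS : compact S.
  apply: bounded_closed_compact.
    by exists 1; split => // x x1 y /= ->; exact: ltW.
  rewrite (_ : S = Num.norm @^-1` [set 1])//.
  apply: closed_comp => [x _|]; first exact: norm_continuous.
  exact: closed_eq.
have [c /set_mem cS1 cmin] := EVT_min_rV S0 cS
  (continuous_subspaceT (@quad_form_continuous H)).
exists (quad_form H c).
  rewrite divr_gt0// Hpos//; apply/eqP => c0.
  by move: cS1; rewrite /S/= c0 normr0 => /esym/eqP; rewrite oner_eq0.
move=> v; have [->|v0] := eqVneq v 0.
  by rewrite normr0 expr0n mulr0 q0.
have := cmin (`|v|^-1 *: v) (mem_set (Hnz v v0)).
rewrite quad_formZ exprVn mulrC ler_pdivlMr// exprn_gt0//.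
by rewrite normr_gt0.
Qed.

Lemma partial_min h x i : has_continuous_partials h -> is_minimizer h x ->
  partial i h x = 0.
Proof.
move=> Ch hmin; have [dh _] := Ch i.
have : is_derive x (delta_mx ord0 i) h 0; last by move=> D; exact: derive_val.
apply/is_derive_line/(@derive1_at_min _ _ (-1) 1).
- by lra.
- move=> t _; suff D : is_derive t 1 (fun t => h (x + t *: delta_mx ord0 i))
    (partial i h (x + t *: delta_mx ord0 i)) by case: D.
  exact/is_derive_line_at/derivableP.
- by rewrite in_itv/=; lra.
- by move=> t _; rewrite scale0r addr0; exact: hmin.
Qed.

(** Taylor leaves the Hessian at an intermediate point. Continuity of its entries bounds the error
    by a small multiple of [|v| ^+ 2], and positive definiteness turns this into the fraction [e] of
    the form itself. *)
Lemma near_quadratic_min h x (e : R) : C2 h -> is_minimizer h x -> h x = 0 ->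
  posdef (hess h x) -> 0 < e -> exists2 r, 0 < r & forall v, `|v| < r ->
    (1 - e) * quad_form (hess h x) v <= h (x + v) <=
    (1 + e) * quad_form (hess h x) v.
Proof.
move=> Ch hmin hx0 hpos e0; have [C1h C2h] := Ch.
have [lam lam0 lamP] := posdef_ge hpos.
(* An entrywise error [d] costs at most [n * n * d / 2 * |v| ^+ 2], hence at most
   [e * lam * |v| ^+ 2]; the successor keeps the divisor nonzero. *)
pose d : R := e * lam / (n * n).+1%:R.
have d0 : 0 < d by rewrite divr_gt0// mulr_gt0.
have [r r0 rP] := continuous_common_radius x
  (fun p : 'I_n * 'I_n => (C2h p.1 p.2).2) d0.
exists r => // v vr.
have [t /andP[t0 t1]] := taylor2_rV x v Ch.
rewrite hx0 big1 ?addr0 ?add0r; last by move=> i _; rewrite partial_min ?mulr0.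
rewrite -/(quad_form _ v) => ->.
suff : `|quad_form (hess h (x + t *: v)) v - quad_form (hess h x) v| <=
    e * quad_form (hess h x) v.
  by rewrite ler_distl mulrBl mulrDl mul1r.
rewrite -quad_formB (@le_trans _ _ ((n * n)%:R * d / 2 * `|v| ^+ 2))//.
  apply: quad_form_le => i j; rewrite !mxE distrC.
  apply/ltW/(rP _ _ (i, j)).
  by rewrite opprD addNKr normrN normrZ ger0_norm// (le_lt_trans _ vr)// ler_piMl.
apply: le_trans (ler_wpM2l (ltW e0) (lamP v)); rewrite [leRHS]mulrA.
rewrite ler_wpM2r// /d mulrCA -mulrA ler_piMr ?mulr_ge0// ?ltW//.
rewrite ltr_pdivrMr// ltr_pdivrMr// mul1r -natrM ltr_nat.
by lia.
Qed.

End directional_calculus.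

(** * Lebesgue measure on row vectors *)

Section lebesgue_affine.
Context {R : realType}.
Local Notation mu := (@lebesgue_measure R).
Local Notation RR := (measurableTypeR R).

Lemma measurable_affine (a b : R) :
  measurable_fun setT (fun x : RR => a * x + b : RR).
Proof. by apply: measurable_funD => //; exact: measurable_funM. Qed.

(** The right side is a measure in [A] that agrees with Lebesgue measure on half-open intervals, so
    uniqueness applies. *)
Lemma lebesgue_measure_affine (a b : R) (A : set R) : 0 < a -> measurable A ->
  mu A = (a%:E * mu ((fun x => a * x + b)%R @^-1` A))%E.
Proof.
move=> a0 mA.
have maff := measurable_affine a b.
pose k : {nonneg R} := NngNum (ltW a0).
rewrite (lebesgue_measure_unique
  (mu := mscale k (pushforward mu (fun x : RR => a * x + b : RR))))//.
move=> _ [[x y]] _ <-.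
transitivity (a%:E * mu `]((x - b) / a)%R, ((y - b) / a)%R])%E; last first.
  congr (_ * mu _)%E; apply/seteqP.
  by split=> z; rewrite /= !in_itv/= ltr_pdivrMr// ler_pdivlMr//;
    rewrite ltrBlDr lerBrDr [z * a]mulrC.
rewrite !lebesgue_measure_itv/= !lte_fin ltr_pM2r ?invr_gt0// ltrD2r.
case: ifPn => _; last by rewrite mule0.
rewrite -EFinB -EFinM; congr (_%:E).
by rewrite -mulrBl mulrC divfK ?gt_eqF//; ring.
Qed.

Lemma ge0_integral_affine (a b : R) (g : R -> \bar R) : 0 < a ->
  measurable_fun setT g -> (forall x, 0 <= g x)%E ->
  (\int[mu]_x g x = a%:E * \int[mu]_x g (a * x + b)%R)%E.
Proof.
move=> a0 mg g0.
have maff := measurable_affine a b.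
pose k : {nonneg R} := NngNum (ltW a0).
have := @ge0_integral_pushforward _ _ _ _ R _ maff mu setT g measurableT mg
  (fun y _ => g0 y).
rewrite preimage_setT => <-.
rewrite -(ge0_integral_mscale _ _ k)//.
by apply: eq_measure_integral => // A mA _; exact: lebesgue_measure_affine.
Qed.

End lebesgue_affine.

Section lebesgue_rV_theory.
Context {R : realType}.

Lemma measurable_rV_affine n (a : R) (b : 'rV[R]_n) :
  measurable_fun setT (fun x : 'rV[R]_n => a *: x + b).
Proof.
apply: measurable_fun_coordP => i.
under eq_fun do rewrite !mxE.
apply: measurable_funD => //; apply: measurable_funM => //.
exact: measurable_coord.
Qed.

Lemma rVcons_ord0 n (p : measurableTypeR R * 'rV[R]_n) : rVcons p ord0 ord0 = p.1.
Proof. by rewrite -[in RHS](rVconsK p). Qed.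

Lemma rVcons_lift n (p : measurableTypeR R * 'rV[R]_n) i :
  rVcons p ord0 (lift ord0 i) = p.2 ord0 i.
Proof. by rewrite -[in RHS](rVconsK p) /= mxE. Qed.

Lemma rVcons_affine n (a x : R) (b : 'rV[R]_n.+1) (y : 'rV[R]_n) :
  rVcons ((a * x + b ord0 ord0)%R, a *: y + \row_i b ord0 (lift ord0 i)) =
  a *: rVcons (x, y) + b.
Proof.
apply/rowP => i; rewrite [RHS]mxE [X in _ = X + _]mxE -[0]/ord0.
case: (unliftP ord0 i) => [j ->|->]; last by rewrite !rVcons_ord0.
by rewrite !rVcons_lift/= !mxE.
Qed.

(** True by computation: the product measure is defined by integrating the measures of sections. *)
Lemma lebesgue_rVS n (A : set 'rV[R]_n.+1) :
  lebesgue_rV n.+1 A =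
  (\int[lebesgue_measure]_x lebesgue_rV n (xsection (@rVcons R n @^-1` A) x))%E.
Proof. by []. Qed.

Lemma measurable_rVcons_preimage n (A : set 'rV[R]_n.+1) :
  measurable A -> measurable (@rVcons R n @^-1` A).
Proof. by move=> mA; rewrite -[X in measurable X]setTI; exact: measurable_rVcons. Qed.

(** Induction on the dimension: the change of variable in the first coordinate yields one factor
    [a], the induction hypothesis on sections the remaining [a ^+ n]. The translation is generalized
    because sections see only its tail [b']. *)
Lemma lebesgue_rV_affine n (a : R) (b : 'rV[R]_n) (A : set 'rV[R]_n) :
  0 < a -> measurable A ->
  lebesgue_rV n A =
  ((a ^+ n)%:E * lebesgue_rV n ((fun x => a *: x + b)%R @^-1` A))%E.
Proof.
move=> a0; elim: n b A => [|n IH] b A mA.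
  rewrite expr0 mul1e; congr (lebesgue_rV 0 _); apply/seteqP.
  by split=> x /=; rewrite (thinmx0 x) (thinmx0 (_ + _)).
have mA' := measurable_rVcons_preimage mA.
have mB : measurable ((fun x => a *: x + b) @^-1` A).
  by rewrite -[X in measurable X]setTI; exact: measurable_rV_affine.
have mB' := measurable_rVcons_preimage mB.
rewrite !lebesgue_rVS (ge0_integral_affine (b ord0 ord0) a0)//; last first.
  exact: measurable_fun_xsection.
pose b' : 'rV[R]_n := \row_i b ord0 (lift ord0 i).
have E x : (fun y => a *: y + b') @^-1`
    xsection (@rVcons R n @^-1` A) (a * x + b ord0 ord0) =
    xsection (@rVcons R n @^-1` ((fun x => a *: x + b) @^-1` A)) x.
  apply/seteqP; split=> y; rewrite /xsection/= !inE/= -rVcons_affine//.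
rewrite exprS EFinM -muleA; congr (_ * _)%E.
rewrite -ge0_integralZl//; last 2 first.
- exact: measurable_fun_xsection.
- by rewrite lee_fin exprn_ge0 ?ltW.
apply: eq_integral => x _; rewrite (IH b'); last exact: measurable_xsection.
by rewrite E.
Qed.

(** For [r >= 0], the closed ball of the max norm; stated by coordinates so that [rVcons] splits it
    into an interval times a smaller box. *)
Definition rV_box n (r : R) : set 'rV[R]_n := [set v | forall i, `|v ord0 i| <= r].

Lemma rV_boxS n (r : R) :
  @rVcons R n @^-1` @rV_box n.+1 r = `[- r, r]%classic `*` @rV_box n r.
Proof.
apply/seteqP; split=> [p /= pr|p [/=]].
  split=> [|i] /=; last by rewrite -rVcons_lift.
  by rewrite in_itv/= -ler_norml -(rVcons_ord0 p).
rewrite in_itv/= -ler_norml => p1 p2 i.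
case: (unliftP ord0 i) => [j ->|->]; first by rewrite rVcons_lift.
by rewrite rVcons_ord0.
Qed.

Lemma measurable_rV_box n (r : R) : measurable (@rV_box n r).
Proof.
rewrite (_ : @rV_box n r = \bigcap_(i in [set: 'I_n]) (fun v : 'rV[R]_n => v ord0 i) @^-1` `[- r, r]).
  apply: fin_bigcap_measurable => // i _.
  by rewrite -[X in measurable X]setTI; exact: measurable_coord.
apply/seteqP; split=> v /= vr i; first by rewrite /= in_itv/= -ler_norml.
by rewrite ler_norml; have := vr i Logic.I; rewrite /= in_itv.
Qed.

Lemma lebesgue_rV_box n (r : R) : 0 <= r ->
  lebesgue_rV n (@rV_box n r) = ((2 * r) ^+ n)%:E.
Proof.
move=> r0; elim: n => [|n IH].
  rewrite expr0 /= diracE mem_set//.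
  by case.
transitivity ((lebesgue_measure \x lebesgue_rV n)%E (@rVcons R n @^-1` @rV_box n.+1 r)) => //.
rewrite rV_boxS product_measure1E//; last exact: measurable_rV_box.
rewrite IH/= lebesgue_measure_itv/= lte_fin.
rewrite exprS EFinM; case: ltP => rr.
  by rewrite -EFinB opprK mulr_natl.
have -> : r = 0 by lra.
by rewrite mulr0.
Qed.

(** Links the topology to the coordinate sigma-algebra: an open set is the union of the countably
    many open boxes inside it with rational centre and radius [1 / (k + 1)]. *)
Lemma open_measurable_rV n (A : set 'rV[R]_n) : open A -> measurable A.
Proof.
move=> oA.
pose box (p : 'rV[rat]_n * nat) : set 'rV[R]_n :=
  [set y | forall i, `|y ord0 i - ratr (p.1 ord0 i)| < p.2.+1%:R^-1].
have mbox p : measurable (box p).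
  rewrite (_ : box p = \bigcap_(i in [set: 'I_n]) (fun v : 'rV[R]_n => v ord0 i) @^-1`
      `]ratr (p.1 ord0 i) - p.2.+1%:R^-1, ratr (p.1 ord0 i) + p.2.+1%:R^-1[).
    apply: fin_bigcap_measurable => // i _.
    by rewrite -[X in measurable X]setTI; exact: measurable_coord.
  apply/seteqP; split=> v /= vr i; first by rewrite /= in_itv/= -ltr_distl.
  by rewrite ltr_distl; have := vr i Logic.I; rewrite /= in_itv.
have -> : A = \bigcup_p (if `[< box p `<=` A >] then box p else set0).
  apply/seteqP; split=> [x Ax|x [p _]]; last by case: asboolP => // pA /pA.
  have /nbhs_ballP[r /= r0 rA] : nbhs x A by exact: open_nbhs_nbhs.
  (* Half of [r] pays for the distance from [x] to the rational centre, half for the distance from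
     the centre to a point of the box. *)
  have [k kr] : exists k, k.+1%:R^-1 < r / 2.
    exists (Num.truncn (r / 2)^-1).
    by rewrite invf_plt ?posrE ?divr_gt0// truncnS_gt.
  have qP i : exists q : rat, `|x ord0 i - ratr q| < k.+1%:R^-1.
    have k0 : 0 < k.+1%:R^-1 :> R by rewrite invr_gt0.
    have [|q] := @rat_in_itvoo R (x ord0 i - k.+1%:R^-1) (x ord0 i + k.+1%:R^-1).
      by rewrite ltrD2l (@lt_trans _ _ 0)// oppr_lt0.
    by rewrite in_itv/= => qx; exists q; rewrite distrC ltr_distl.
  pose c : 'rV[rat]_n := \row_i projT1 (cid (qP i)).
  have cP i : `|x ord0 i - ratr (c ord0 i)| < k.+1%:R^-1.
    by rewrite mxE; case: cid.
  exists (c, k) => //; case: asboolP => [_|[]]; first exact: cP.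
  move=> y yc; apply: rA; rewrite -ball_normE/= -[ltLHS]/(mx_norm _) mx_normrE.
  apply/bigmax_lt => // -[i0 i] _ /=; rewrite !mxE (ord1 i0).
  rewrite (le_lt_trans (ler_distD (ratr (c ord0 i)) _ _))//.
  rewrite [ltRHS]splitr ltrD//; first exact: lt_trans (cP i) kr.
  by rewrite distrC; exact: lt_trans (yc i) kr.
apply: countable_bigcupT_measurable => [|p]; first exact: countableP.
by case: asboolP => // _; exact: mbox.
Qed.

Lemma continuous_measurable_rV n (f : 'rV[R]_n -> R) :
  continuous f -> measurable_fun setT f.
Proof.
move=> /continuousP cf; move=> _; apply: (measurability _ (RGenOpens.measurableE R)) => //.
move=> _ [_ [a [b ->]] <-]; rewrite setTI.
by apply: open_measurable_rV; apply: (cf `]a, b[%classic); exact: interval_open.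
Qed.

End lebesgue_rV_theory.

(** * Volumes of sublevel sets *)

Section real_powers.
Context {R : realType}.

Lemma powR_half (s : R) k : 0 <= s -> s `^ (k%:R / 2) = Num.sqrt s ^+ k.
Proof.
by move=> s0; rewrite mulrC powRrM powR12_sqrt// powR_mulrn// sqrtr_ge0.
Qed.

Lemma powR_continuous (a p : R) : 0 < a -> {for a, continuous (fun x => x `^ p)}.
Proof.
move=> a0; apply: differentiable_continuous; apply/derivable1_diffP.
by case: (is_derive1_powR p a0).
Qed.

End real_powers.

Section norms.
Context {R : realType} {n : nat}.
Implicit Types (v : 'rV[R]_n) (r : R).

Lemma norm_le_rV_box v r : `|v| <= r -> rV_box r v.
Proof. by move=> vr i; rewrite (le_trans (coord_le_norm _ _)). Qed.

Lemma rV_box_norm_le v r : 0 <= r -> rV_box r v -> `|v| <= r.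
Proof.
move=> r0 vr; rewrite -[leLHS]/(mx_norm _) mx_normrE.
by apply/bigmax_le => // -[i0 i] _ /=; rewrite (ord1 i0); exact: vr.
Qed.

(** Coercivity is phrased with the Euclidean norm, volumes are estimated by max-norm boxes; this
    passes from one to the other. *)
Lemma norm_le_enorm v : `|v| <= enorm v.
Proof.
apply: rV_box_norm_le => [|i]; first exact: sqrtr_ge0.
rewrite -sqrtr_sqr ler_sqrt ?sumr_ge0// => [|j _]; last exact: sqr_ge0.
by rewrite (bigD1 i)//= lerDl sumr_ge0// => j _; exact: sqr_ge0.
Qed.

End norms.

Lemma le_measure_subset d (T : measurableType d) (R : realType)
    (mu : {measure set T -> \bar R}) (A B : set T) :
  measurable A -> measurable B -> A `<=` B -> (mu A <= mu B)%E.
Proof. by move=> mA mB; apply: le_measure; rewrite inE. Qed.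

(** * The ellipsoid of the Hessian form *)

Section quadratic_volume.
Context {R : realType} {n : nat}.
Variable H : 'M[R]_n.
Hypothesis Hpos : posdef H.
Implicit Types (v : 'rV[R]_n).

Definition quad_vol : R := fine (lebesgue_rV n [set v | quad_form H v <= 1]).

Lemma measurable_quad_sublevel (x0 : 'rV[R]_n) (s : R) :
  measurable [set y | quad_form H (y - x0) <= s].
Proof.
rewrite (_ : mkset _ = (fun y => 1 *: y + - x0) @^-1`
    (quad_form H @^-1` `]-oo, s])); last first.
  by apply/seteqP; split => y; rewrite /= in_itv/= scale1r.
rewrite -[X in measurable X]setTI; apply: measurable_rV_affine => //.
rewrite -[X in measurable X]setTI.
by apply: continuous_measurable_rV => //; exact: quad_form_continuous.
Qed.

Lemma measurable_quad_unit : measurable [set v | quad_form H v <= 1].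
Proof.
have := measurable_quad_sublevel 0 1.
by rewrite (_ : mkset _ = [set v | quad_form H v <= 1])//;
  apply/seteqP; split => v; rewrite /= subr0.
Qed.

(** Gives finiteness of [quad_vol], without which [fine] would return the default 0; the inclusion
    of a box in the next lemma gives positivity, so that [quad_vol] can be divided by. *)
Lemma quad_unit_subset : exists2 r : R, 0 < r &
  [set v | quad_form H v <= 1] `<=` rV_box r.
Proof.
have [lam lam0 lamP] := posdef_ge Hpos.
exists (Num.sqrt lam^-1); first by rewrite sqrtr_gt0 invr_gt0.
move=> v /= qv; apply: norm_le_rV_box.
rewrite -[leLHS]ger0_norm// -sqrtr_sqr ler_wsqrtr//.
by rewrite -[leRHS]mul1r ler_pdivlMr// mulrC (le_trans (lamP v)).
Qed.

Lemma quad_unit_superset : exists2 r : R, 0 < r &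
  rV_box r `<=` [set v | quad_form H v <= 1].
Proof.
pose M : R := \sum_(p : 'I_n * 'I_n) `|H p.1 p.2|.
have HM i j : `|H i j| <= M.
  by rewrite /M (bigD1 (i, j))//= lerDl sumr_ge0.
have M0 : 0 <= M by rewrite sumr_ge0.
pose K := (n * n)%:R * M / 2 + 1.
have K0 : 0 < K by rewrite ltr_wpDl// divr_ge0// mulr_ge0.
exists (Num.sqrt K^-1); first by rewrite sqrtr_gt0 invr_gt0.
move=> v vr /=; apply: le_trans (ler_norm _) _.
apply: le_trans (quad_form_le v HM) _.
have : `|v| ^+ 2 <= K^-1.
  have K1 : 0 <= K^-1 by rewrite invr_ge0 ltW.
  rewrite -[leRHS]sqr_sqrtr// ler_pXn2r ?nnegrE ?sqrtr_ge0//.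
  by apply: rV_box_norm_le => //; exact: sqrtr_ge0.
move=> vK; apply: (@le_trans _ _ (K * `|v| ^+ 2)).
  by rewrite ler_wpM2r ?sqr_ge0// lerDl.
by rewrite -ler_pdivlMl// mulr1.
Qed.

Lemma lebesgue_quad_unit :
  lebesgue_rV n [set v | quad_form H v <= 1] = quad_vol%:E.
Proof.
have [r r0 rP] := quad_unit_subset.
rewrite fineK// ge0_fin_numE//.
apply: (@le_lt_trans _ _ (lebesgue_rV n (rV_box r))).
  apply: le_measure_subset rP; first exact: measurable_quad_unit.
  exact: measurable_rV_box.
by rewrite lebesgue_rV_box ?ltW// ltry.
Qed.

Lemma quad_vol_gt0 : 0 < quad_vol.
Proof.
have [r r0 rP] := quad_unit_superset.
rewrite -lte_fin -lebesgue_quad_unit.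
apply: (@lt_le_trans _ _ (lebesgue_rV n (rV_box r))).
  by rewrite lebesgue_rV_box ?ltW// lte_fin exprn_gt0// mulr_gt0.
apply: le_measure_subset rP; first exact: measurable_rV_box.
exact: measurable_quad_unit.
Qed.

(** Source of the exponent [n / 2]: the form has degree 2, so [v |-> sqrt s *: v + x0] maps the unit
    sublevel set onto this one, with volume factor [sqrt s ^+ n]. *)
Lemma lebesgue_quad_sublevel (x0 : 'rV[R]_n) (s : R) : 0 < s ->
  lebesgue_rV n [set y | quad_form H (y - x0) <= s] =
  (s `^ (n%:R / 2) * quad_vol)%:E.
Proof.
move=> s0; rewrite EFinM -lebesgue_quad_unit powR_half ?ltW//.
rewrite (@lebesgue_rV_affine _ _ (Num.sqrt s) x0) ?sqrtr_gt0//; last first.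
  exact: measurable_quad_sublevel.
congr (_ * lebesgue_rV n _)%E; apply/seteqP.
by split=> v; rewrite /= addrK quad_formZ (sqr_sqrtr (ltW s0)) ger_pMr.
Qed.

End quadratic_volume.

(** * Sublevel sets of the function *)

Section sublevel_volume.
Context {R : realType} {n : nat}.
Variables (f : 'rV[R]_n -> R) (xstar : 'rV[R]_n).
Hypothesis f_cont : continuous f.
Hypothesis f_coercive : f x / ln (1 + enorm x) @[x --> at_infinity] --> +oo.

Definition sublevel_vol (x : R) : \bar R := lebesgue_rV n [set y | f y <= x].

Lemma measurable_sublevel (x : R) : measurable [set y | f y <= x].
Proof.
rewrite (_ : mkset _ = f @^-1` `]-oo, x]); last first.
  by apply/seteqP; split => y; rewrite /= in_itv.
rewrite -[X in measurable X]setTI.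
by apply: continuous_measurable_rV.
Qed.

(** Requiring [1 <= M] makes the logarithm positive, so the quotient can be cleared, and later
    bounds it below by [ln 2]. *)
Lemma coercive_ge (K : R) : exists2 M : R, 1 <= M &
  forall y, M < enorm y -> K * ln (1 + enorm y) <= f y.
Proof.
have [M _ MP] := f_coercive (nbhs_pinfty_ge (num_real K)).
exists (Order.max 1 M) => [|y]; first by rewrite le_max lexx.
rewrite gt_max => /andP[y1 My]; have := MP y My.
rewrite /= ler_pdivlMr// ln_gt0//; lra.
Qed.

(** On [f y <= x], coercivity with factor [K] gives [enorm y <= M * expR (x / K)]. The enclosing box
    has volume [(2 * M) ^+ n * expR (n * x / K)], and [K = (n + 1) / a] brings the rate below
    [a]. *)
Lemma sublevel_vol_le_expR (a : R) : 0 < a -> exists2 C : R, 0 < C &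
  forall x, 0 <= x -> (sublevel_vol x <= (C * expR (a * x))%:E)%E.
Proof.
move=> a0; pose K : R := n.+1%:R / a.
have K0 : 0 < K by rewrite divr_gt0.
have [M M1 MP] := coercive_ge K.
have M0 : 0 < M by rewrite (lt_le_trans _ M1).
exists ((2 * M) ^+ n); first by rewrite exprn_gt0// mulr_gt0.
move=> x x0; pose r := M * expR (x / K).
have r0 : 0 <= r by rewrite mulr_ge0 ?expR_ge0// ltW.
apply: (@le_trans _ _ (lebesgue_rV n (rV_box r))).
  apply: le_measure_subset; [exact: measurable_sublevel|exact: measurable_rV_box|].
  move=> y /= fy; apply/norm_le_rV_box/(le_trans (norm_le_enorm y)).
  have e1 : 1 <= expR (x / K) by rewrite -expR0 ler_expR divr_ge0// ltW.
  have [yM|My] := leP (enorm y) M.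
    by rewrite (le_trans yM)// /r ler_peMr// ltW.
  have := le_trans (MP y My) fy.
  rewrite -ler_pdivlMl// mulrC -ler_expR lnK; last first.
    by rewrite posrE ltr_wpDr// sqrtr_ge0.
  move=> h; apply: (@le_trans _ _ (expR (x / K))); first by lra.
  by rewrite /r ler_peMl// expR_ge0.
rewrite lebesgue_rV_box// lee_fin /r mulrA exprMn ler_wpM2l//.
  by rewrite exprn_ge0// mulr_ge0// ltW.
rewrite -expRM_natl ler_expR /K invf_div mulrCA.
rewrite [leRHS]mulrC ler_wpM2l// mulrCA ler_piMr//; first exact: ltW.
by rewrite ler_pdivrMr// mul1r ler_nat.
Qed.

Lemma sublevel_vol_fin (x : R) : sublevel_vol x \is a fin_num.
Proof.
have [C C0 /(_ _ (normr_ge0 x)) CP] := sublevel_vol_le_expR ltr01.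
rewrite ge0_fin_numE ?measure_ge0// (le_lt_trans _ (ltry (C * expR (1 * `|x|))))//.
apply: le_trans CP; apply: le_measure_subset; [exact: measurable_sublevel..|].
by move=> y /= /le_trans; apply; exact: ler_norm.
Qed.

Hypothesis f_min : is_minimizer f xstar.
Hypothesis f_uniq : forall x, is_minimizer f x -> x = xstar.
Hypothesis f_min0 : f xstar = 0.

(** Away from [xstar], [f] is bounded below by a positive number: by its minimum [c] on the compact
    set [A], positive by uniqueness of the minimizer, and by [ln 2] beyond Euclidean norm [M]. *)
Lemma sublevel_near_min (r : R) : 0 < r ->
  exists2 s : R, 0 < s & forall y, f y <= s -> `|y - xstar| < r.
Proof.
move=> r0; have [M M1 MP] := coercive_ge 1.
pose A := [set y : 'rV[R]_n | `|y| <= M /\ r <= `|y - xstar|].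
have cA : compact A.
  apply: bounded_closed_compact.
    by exists M; split; [exact: num_real|] => x Mx y /= [yM _]; rewrite (le_trans yM)// ltW.
  rewrite (_ : A = [set y | `|y| <= M] `&` [set y | r <= `|y - xstar|])//.
  apply: closedI.
    rewrite (_ : mkset _ = Num.norm @^-1` [set z | z <= M])//.
    apply: closed_comp => [y _|]; [exact: norm_continuous|exact: closed_le].
  rewrite (_ : mkset _ = (fun y => `|y - xstar|) @^-1` [set z | r <= z])//.
  apply: closed_comp => [y _|]; last exact: closed_ge.
  suff /(_ y) : continuous (fun y : 'rV[R]_n => `|y - xstar|) by [].
  apply/continuous_rVP => x e e0; exists e => // z.
  apply: le_lt_trans; apply: le_trans (ler_dist_dist _ _) _.
  by rewrite opprB addrA subrK.
have fpos y : r <= `|y - xstar| -> 0 < f y.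
  move=> ry; rewrite lt_neqAle -{2}f_min0 f_min andbT; apply/eqP => fy0.
  move: ry; rewrite (f_uniq (x := y)) ?subrr ?normr0 ?leNgt ?r0//.
  by move=> z; rewrite -fy0 -f_min0; exact: f_min.
have [c c0 cP] : exists2 c : R, 0 < c & forall y, A y -> c <= f y.
  have [A0|/nonemptyPn/seteqP[A0 _]] := pselect (A !=set0); last first.
    by exists 1 => // y /A0.
  have [y0 /set_mem Ay0 y0P] := EVT_min_rV A0 cA (continuous_subspaceT f_cont).
  exists (f y0); first by apply: fpos; case: Ay0.
  by move=> y Ay; apply: y0P; rewrite inE.
pose l : R := ln 2.
have l0 : 0 < l by rewrite ln_gt0// ltr1n.
(* Halving makes the level strictly smaller than both lower bounds. *)
exists (Order.min c l / 2); first by rewrite divr_gt0// lt_min c0.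
move=> y fy; rewrite ltNge; apply/negP => ry.
have sc : Order.min c l / 2 < c.
  by rewrite ltr_pdivrMr// mulr_natr mulr2n (le_lt_trans (_ : _ <= c)) ?ltrDl// ge_min lexx.
have sl : Order.min c l / 2 < l.
  by rewrite ltr_pdivrMr// mulr_natr mulr2n (le_lt_trans (_ : _ <= l)) ?ltrDl// ge_min lexx orbT.
have [yM|My] := leP (enorm y) M.
  have : c <= f y by apply: cP; split => //; exact: le_trans (norm_le_enorm y) yM.
  by rewrite leNgt (le_lt_trans fy sc).
have := MP y My; rewrite mul1r leNgt => /negP; apply.
apply: (le_lt_trans fy); apply: (lt_le_trans sl).
by rewrite ler_ln ?posrE//; lra.
Qed.

Hypothesis f_C2 : C2 f.
Let H := hess f xstar.
Hypothesis H_pos : posdef H.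
Let p : R := n%:R / 2.

(** The comparison with the form holds only within [r] of [xstar], so each inclusion is localized
    first: points of the inner ellipsoid by [posdef_ge] (hence the threshold [lam * r ^+ 2]), points
    of the sublevel set by [sublevel_near_min] (hence [s]). *)
Lemma sublevel_vol_sandwich (e : R) : 0 < e -> e < 1 ->
  exists2 d : R, 0 < d & forall x, 0 < x -> x < d ->
    (((x / (1 + e)) `^ p * quad_vol H)%:E <= sublevel_vol x <=
     ((x / (1 - e)) `^ p * quad_vol H)%:E)%E.
Proof.
move=> e0 e1.
have [r r0 rP] := near_quadratic_min f_C2 f_min f_min0 H_pos e0.
have [s s0 sP] := sublevel_near_min r0.
have [lam lam0 lamP] := posdef_ge H_pos.
have e10 : 0 < 1 + e by lra.
have e20 : 0 < 1 - e by lra.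
exists (Order.min s (lam * r ^+ 2)); first by rewrite lt_min s0 mulr_gt0// exprn_gt0.
move=> x x0; rewrite lt_min => /andP[xs xr].
rewrite -!(lebesgue_quad_sublevel H_pos xstar) ?divr_gt0//.
apply/andP; split; apply: le_measure_subset;
  [exact: measurable_quad_sublevel|exact: measurable_sublevel| |
   exact: measurable_sublevel|exact: measurable_quad_sublevel|] => y /=.
- rewrite ler_pdivlMr// mulrC => qy.
  have yr : `|y - xstar| < r.
    have : lam * `|y - xstar| ^+ 2 < lam * r ^+ 2.
      apply: le_lt_trans xr; apply: le_trans qy; apply: le_trans (lamP _) _.
      rewrite ler_peMl ?lerDl ?(ltW e0)// (le_trans _ (lamP _))// mulr_ge0//.
      exact: ltW.
    by rewrite ltr_pM2l// ltr_pXn2r ?nnegrE ?(ltW r0).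
  have /andP[_] := rP _ yr; rewrite [xstar + _]addrC subrK => /le_trans; exact.
- move=> fy; have yr := sP y (le_trans fy (ltW xs)).
  rewrite ler_pdivlMr// mulrC.
  by have /andP[+ _] := rP _ yr; rewrite [xstar + _]addrC subrK => /le_trans; apply.
Qed.

Lemma sublevel_vol_asymp :
  fine (sublevel_vol x) / x `^ p @[x --> 0^'+] --> quad_vol H.
Proof.
apply/cvgrPdist_le => eta eta0.
have V0 := quad_vol_gt0 H_pos.
have K (u : R -> R) : u e @[e --> (0 : R)^'+] --> (1 : R) ->
    (u e)^-1 `^ p * quad_vol H @[e --> (0 : R)^'+] --> quad_vol H.
  move=> u1; rewrite -[X in _ --> X]mul1r; apply: cvgMr_tmp.
  have v1 : (u e)^-1 @[e --> (0 : R)^'+] --> (1 : R).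
    by rewrite -[X in _ --> X]invr1; apply: cvgV u1; exact: oner_neq0.
  have := cvg_comp _ _ v1 (@powR_continuous _ _ p ltr01).
  by rewrite powR1.
have K1 : (1 + e)^-1 `^ p * quad_vol H @[e --> (0 : R)^'+] --> quad_vol H.
  apply: K; rewrite -[X in _ --> X]addr0.
  by apply: cvgD; [exact: cvg_cst|exact: cvg_at_right_filter cvg_id].
have K2 : (1 - e)^-1 `^ p * quad_vol H @[e --> (0 : R)^'+] --> quad_vol H.
  apply: K; rewrite -[X in _ --> X]subr0.
  by apply: cvgB; [exact: cvg_cst|exact: cvg_at_right_filter cvg_id].
(* [e] is fixed first, so that both sandwich constants are within [eta] of [quad_vol H]; only then
   is [x] taken below the resulting [d]. *)
near (0 : R)^'+ => e.
have e0 : 0 < e by [].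
have e1 : e < 1 by near: e; exact: nbhs_right_lt.
have B1 : `|quad_vol H - ((1 + e)^-1 `^ p) * quad_vol H| < eta.
  by near: e; exact: cvgr_dist_lt.
have B2 : `|quad_vol H - ((1 - e)^-1 `^ p) * quad_vol H| < eta.
  by near: e; exact: cvgr_dist_lt.
have [d d0 dP] := sublevel_vol_sandwich e0 e1.
near=> x.
have x0 : 0 < x by [].
have xd : x < d by near: x; exact: nbhs_right_lt.
have xp : 0 < x `^ p by exact: powR_gt0.
have E u : 0 < u -> (x / u) `^ p = x `^ p * u^-1 `^ p.
  by move=> u0; rewrite powRM ?invr_ge0; [|exact: ltW..].
have /andP[B3 B4] : x `^ p * ((1 + e)^-1 `^ p * quad_vol H) <=
    fine (sublevel_vol x) <= x `^ p * ((1 - e)^-1 `^ p * quad_vol H).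
  rewrite -!lee_fin fineK ?sublevel_vol_fin// !mulrA -!E; [|lra..].
  exact: dP.
move: B1 B2; rewrite !ltr_distl ler_distl => /andP[_ B1] /andP[B2 _].
rewrite -ler_pdivlMl// mulrC in B3; rewrite -ler_pdivrMl// mulrC in B4.
by apply/andP; split; lra.
Unshelve. all: by end_near. Qed.

(** The factor [x ^ p] is what survives division by [rho ^ p]. Below [d] it comes from the
    asymptotics, with ratio at most [quad_vol H + 1]; above [d] it is inserted into the exponential
    bound through [1 <= (x / d) ^ p]. *)
Lemma sublevel_vol_le (a : R) : 0 < a -> exists2 C : R, 0 < C &
  forall x, 0 < x -> fine (sublevel_vol x) <= C * x `^ p * expR (a * x).
Proof.
move=> a0.
have [C C0 CP] := sublevel_vol_le_expR a0.
have V0 := quad_vol_gt0 H_pos.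
have [d /= d0 dP] : \forall x \near (0 : R)^'+,
    `|quad_vol H - fine (sublevel_vol x) / x `^ p| < 1.
  by have /cvgrPdist_lt/(_ _ ltr01) := sublevel_vol_asymp.
have dp : 0 < d `^ p by exact: powR_gt0.
exists (quad_vol H + 1 + C / d `^ p).
  by rewrite addr_gt0 ?divr_gt0// addr_gt0.
move=> x x0.
have xp : 0 < x `^ p by exact: powR_gt0.
have ex : 1 <= expR (a * x) by rewrite -expR0 ler_expR mulr_ge0// ltW.
have xp0 := ltW xp.
have Cd0 : 0 <= C / d `^ p by rewrite divr_ge0// ltW.
have V10 : 0 <= quad_vol H + 1 by rewrite addr_ge0// ltW.
have [xd|dx] := ltP x d.
  have := dP x; rewrite /= sub0r normrN gtr0_norm// => /(_ xd x0).
  rewrite ltr_distlC => /andP[_]; rewrite ltr_pdivrMr// => /ltW /le_trans; apply.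
  apply: (@le_trans _ _ ((quad_vol H + 1 + C / d `^ p) * x `^ p)).
    by rewrite ler_wpM2r// lerDl.
  by rewrite ler_peMr// mulr_ge0// addr_ge0.
have := CP x (ltW x0).
rewrite -(fineK (sublevel_vol_fin x)) lee_fin => /le_trans; apply.
rewrite ler_wpM2r ?expR_ge0//.
apply: (@le_trans _ _ (C / d `^ p * x `^ p)).
  rewrite mulrAC ler_pdivlMr// ler_wpM2l//; first exact: ltW.
  by apply: ge0_ler_powR; rewrite ?nnegrE ?divr_ge0//; exact: ltW.
by rewrite ler_wpM2r// lerDr.
Qed.

End sublevel_volume.

(** * Laplace asymptotics of the normalizing constant *)

Section layer_cake.
Context {R : realType}.
Local Notation leb := (@lebesgue_measure R).

Lemma integral_expRN (k t : R) : 0 < k ->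
  (\int[leb]_(s in `[t, +oo[) (expR (- k * s))%:E = (k^-1 * expR (- k * t))%:E)%E.
Proof.
move=> k0.
pose F (s : R) := - (k^-1 * expR (- k * s)).
have dF (s : R) : is_derive s 1 F (expR (- k * s)).
  have Dl : is_derive s 1 (fun s : R => - k * s) (- k).
    by have := is_deriveZ (- k) (is_derive_id s (1 : R)); rewrite [_ *: (1 : R)]mulr1.
  have De := @is_derive1_comp R expR _ s _ _ (is_derive_expR (- k * s)) Dl.
  have := is_deriveZ (- k^-1) De.
  rewrite (_ : - k^-1 *: _ = expR (- k * s)); last first.
    by rewrite [LHS]mulrCA mulrNN mulVf ?mulr1// gt_eqF.
  rewrite (_ : - k^-1 \*: _ = F)//.
  by apply/funext => z; rewrite /F -mulNr.
have cF : continuous F.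
  by move=> s; apply/differentiable_continuous/derivable1_diffP; case: (dF s).
have ce : continuous (fun s : R => expR (- k * s)).
  move=> s; apply: continuous_comp; last exact: continuous_expR.
  exact: mulrl_continuous.
rewrite (@ge0_continuous_FTC2y _ _ F _ 0).
- by rewrite -EFinB /F opprK add0r.
- by move=> s _; exact: expR_ge0.
- exact: continuous_subspaceT.
- rewrite -oppr0 -(mulr0 k^-1); apply: cvgN; apply: cvgMl_tmp.
  rewrite (_ : (fun x => expR (- k * x)) =
               (fun z => expR (- z)) \o (fun z => k * z)); last first.
    by apply: eq_fun => x; rewrite mulNr.
  apply: (@cvg_comp _ _ _ _ _ _ (pinfty_nbhs R)); last exact: cvgr_expR.
  exact: gt0_cvgMry.
- by move=> s _; case: (dF s).
- by apply: cvg_at_right_filter; exact: cF.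
- by move=> s _; rewrite derive1E; exact: derive_val.
Qed.

(** Write [expR (- g x)] as the integral of [expR (- s)] over [s >= g x] and exchange integrals by
    Tonelli; measurability in [s] comes from the same theorem and is kept for later use. *)
Lemma integral_expRN_layer_cake d (T : measurableType d)
    (mu : {sigma_finite_measure set T -> \bar R}) (g : T -> R) :
  measurable_fun setT g ->
  measurable_fun setT (fun s : R => (expR (- s))%:E * mu [set x | g x <= s]%R)%E /\
  (\int[mu]_x (expR (- g x))%:E =
   \int[leb]_s ((expR (- s))%:E * mu [set x | g x <= s]%R))%E.
Proof.
move=> mg.
pose A := [set z : T * measurableTypeR R | g z.1 <= z.2].
have mA : measurable A.
  rewrite (_ : A = (fun z : T * measurableTypeR R => z.2 - g z.1) @^-1` `[0, +oo[).
    rewrite -[X in measurable X]setTI; apply: measurable_funB => //.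
    exact: measurableT_comp.
  by apply/seteqP; split => z; rewrite /A/= in_itv/= andbT subr_ge0.
pose F (z : T * measurableTypeR R) : \bar R := ((expR (- z.2))%:E * (\1_A z)%:E)%E.
have mF : measurable_fun setT F.
  apply: emeasurable_funM.
    by do 2 apply: measurableT_comp => //; exact: measurableT_comp.
  by apply/measurable_EFinP; exact: measurable_indic.
have F0 z : (0 <= F z)%E by rewrite mule_ge0// lee_fin ?expR_ge0.
have E1 x : (\int[leb]_s F (x, s) = (expR (- g x))%:E)%E.
  transitivity (\int[leb]_(s in `[g x, +oo[) (expR (- 1 * s))%:E)%E.
    rewrite [RHS]integral_mkcond; apply: eq_integral => s _.
    rewrite /F/= patchE indicE mulN1r.
    rewrite (_ : ((x, s) \in A) = (s \in `[g x, +oo[%classic)); last first.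
      by apply/idP/idP; rewrite !inE /A/= in_itv/= andbT.
    by case: ifP => _; rewrite ?mule1 ?mule0.
  by rewrite integral_expRN// invr1 mul1r mulN1r.
have E2 s : (\int[mu]_x F (x, s) = (expR (- s))%:E * mu [set x | g x <= s]%R)%E.
  have ms : measurable [set x | g x <= s].
    rewrite (_ : mkset _ = g @^-1` `]-oo, s]).
      by rewrite -[X in measurable X]setTI; exact: mg.
    by apply/seteqP; split => x; rewrite /= in_itv.
  rewrite -[X in mu X]setIT -integral_indic// -ge0_integralZl//.
  by apply/measurable_EFinP; exact: measurable_indic.
split.
  rewrite (_ : (fun _ => _) = fubini_G mu F); first exact: measurable_fun_fubini_tonelli_G.
  by apply/funext => s; rewrite -E2.
under eq_integral do rewrite -E1.
rewrite (fubini_tonelli F)//.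
by apply: eq_integral => s _; rewrite E2.
Qed.

End layer_cake.

Lemma measurable_expRN (R : realType) (k : R) :
  measurable_fun setT (fun s : R => (expR (- k * s))%:E).
Proof.
by apply/measurable_EFinP/measurableT_comp => //; exact: measurable_funM.
Qed.

(** Raise [s <= (k + 1) * expR (s / (k + 1))], a case of [1 + x <= expR x], to the power [k / 2];
    the rate becomes [k / (2 * (k + 1))], below one half. *)
Lemma powR_le_expR (R : realType) (k : nat) (s : R) : 0 <= s ->
  s `^ (k%:R / 2) <= k.+1%:R `^ (k%:R / 2) * expR (s / 2).
Proof.
move=> s0; have p0 : 0 <= k%:R / 2 :> R by rewrite divr_ge0.
apply: (@le_trans _ _ ((k.+1%:R * expR (s / k.+1%:R)) `^ (k%:R / 2))).
  apply: ge0_ler_powR => //; rewrite ?nnegrE ?mulr_ge0 ?expR_ge0//.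
  rewrite -ler_pdivrMl// mulrC (le_trans _ (expR_ge1Dx _))// lerDr//.
rewrite powRM ?expR_ge0// ler_wpM2l ?powR_ge0//.
rewrite [leLHS]/powR gt_eqF ?expR_gt0// expRK ler_expR.
rewrite mulrACA [k%:R * s]mulrC mulrACA ler_piMr ?divr_ge0//.
by rewrite ler_pdivrMr// mul1r ler_nat.
Qed.

(** * Exponential and Gamma integrals on the half-line *)

Section Gamma_integrals.
Context {R : realType}.
Local Notation leb := (@lebesgue_measure R).

Lemma integrable_expRN (k : R) : 0 < k ->
  leb.-integrable `]0, +oo[ (fun s : R => (expR (- k * s))%:E).
Proof.
move=> k0; have mk := measurable_expRN k.
apply/integrableP; split; first exact: measurable_funTS.
under eq_integral do rewrite /= ger0_norm ?expR_ge0//.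
rewrite integral_itv_obnd_cbnd ?integral_expRN ?ltry//.
exact: measurable_funTS.
Qed.

Lemma measurable_Gamma_integrand (p : R) :
  measurable_fun setT (fun t : R => t `^ p * expR (- t)).
Proof.
apply: measurable_funM; first exact: measurable_powR.
by apply: measurableT_comp => //; exact: measurable_oppr.
Qed.

Lemma integrable_Gamma_half (k : nat) :
  leb.-integrable `]0, +oo[ (fun t : R => (t `^ (k%:R / 2) * expR (- t))%:E).
Proof.
have k2 : 0 < (2^-1 : R) by lra.
have I : leb.-integrable `]0, +oo[ (fun s : R =>
    ((k.+1%:R `^ (k%:R / 2))%:E * (expR (- 2^-1 * s))%:E)%E).
  by apply: integrableZl => //; exact: integrable_expRN.
apply: le_integrable I => //.
  by apply/measurable_EFinP/measurable_funTS; exact: measurable_Gamma_integrand.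
move=> t; rewrite /= in_itv/= andbT => t0.
rewrite lee_fin !ger0_norm ?mulr_ge0 ?powR_ge0 ?expR_ge0//.
apply: le_trans (ler_wpM2r (expR_ge0 _) (powR_le_expR _ (ltW t0))) _.
rewrite -mulrA ler_wpM2l ?powR_ge0// -expRD ler_expR; lra.
Qed.

(** [Gamma] is a real-valued integral, which would default to 0 if infinite, so integrability is
    part of the argument; on [[1, 2]] the integrand is at least [expR (- 2)]. *)
Lemma Gamma_half_gt0 (k : nat) : 0 < Gamma (k%:R / 2 + 1) :> R.
Proof.
rewrite /Gamma/= addrK; have I := integrable_Gamma_half k.
apply: fine_gt0; apply/andP; split; last first.
  by rewrite ltey_eq (integrable_fin_num _ I).
have h1 : (0 < \int[leb]_(t in `[1%R, 2%R]) (expR (- 2))%:E)%E.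
  rewrite integral_cst// mule_gt0 ?lte_fin ?expR_gt0//= lebesgue_measure_itv/=.
  by rewrite lte_fin ltr1n -EFinB lte_fin subr_gt0 ltr1n.
have mG := measurable_Gamma_integrand (k%:R / 2).
have h2 : (\int[leb]_(t in `[1%R, 2%R]) (expR (- 2))%:E <=
    \int[leb]_(t in `[1%R, 2%R]) (t `^ (k%:R / 2) * expR (- t))%:E)%E.
  apply: ge0_le_integral => //.
  - by apply/measurable_EFinP/measurable_funTS.
  - move=> t; rewrite /= in_itv/= => /andP[t1 t2]; rewrite lee_fin.
    rewrite -[leLHS]mul1r ler_pM ?expR_ge0// ?ler_expR ?lerN2//.
    by rewrite -[leLHS](powRr0 t) ler_powR// divr_ge0.
apply: lt_le_trans h1 (le_trans h2 _).
apply: ge0_subset_integral => //.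
- by apply/measurable_EFinP/measurable_funTS.
- by move=> t _; rewrite lee_fin mulr_ge0 ?powR_ge0 ?expR_ge0.
- by move=> t; rewrite /= !in_itv/= andbT => /andP[t1 _]; exact: lt_le_trans t1.
Qed.

End Gamma_integrals.

Section gibbs_normalization.
Context {R : realType} {n : nat}.
Variables (f : 'rV[R]_n -> R) (xstar : 'rV[R]_n).
Hypothesis f_cont : continuous f.
Hypothesis f_coercive : f x / ln (1 + enorm x) @[x --> at_infinity] --> +oo.
Hypothesis f_min : is_minimizer f xstar.
Hypothesis f_uniq : forall x, is_minimizer f x -> x = xstar.
Hypothesis f_min0 : f xstar = 0.
Hypothesis f_C2 : C2 f.
Hypothesis f_posdef : posdef (hess f xstar).
Let V : R := quad_vol (hess f xstar).
Let p : R := n%:R / 2.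
Local Notation leb := (@lebesgue_measure R).

Let m (x : R) : R := fine (sublevel_vol f x).

Let f_ge0 x : 0 <= f x. Proof. by rewrite -f_min0. Qed.

Let m_ge0 x : 0 <= m x. Proof. exact/fine_ge0/measure_ge0. Qed.

Lemma measurable_gibbs_weight (rho : R) :
  measurable_fun setT (EFin \o gibbs_weight f rho).
Proof.
apply/measurable_EFinP; apply: measurableT_comp => //.
apply: measurable_funM => //; apply: measurableT_comp => //.
exact: continuous_measurable_rV.
Qed.

Lemma sublevel_vol_gt0 (x : R) : 0 < x -> (0 < sublevel_vol f x)%E.
Proof.
move=> x0; have h : (2^-1 : R) < 1 by lra.
have h0 : 0 < (2^-1 : R) by lra.
have [d d0 dP] := sublevel_vol_sandwich f_cont f_coercive f_min f_uniq f_min0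
  f_C2 f_posdef h0 h.
pose y := Order.min x (d / 2).
have y0 : 0 < y by rewrite lt_min x0 divr_gt0.
have yd : y < d by rewrite gt_min ltr_pdivrMr// mulr_natr mulr2n ltrDl d0 orbT.
have /andP[+ _] := dP y y0 yd.
move=> /(lt_le_trans _) => /(_ 0%E) my.
apply: (@lt_le_trans _ _ (sublevel_vol f y)).
  apply: my; rewrite lte_fin mulr_gt0 ?quad_vol_gt0// powR_gt0// divr_gt0//.
apply: le_measure_subset; [exact: measurable_sublevel..|].
by move=> z /= /le_trans; apply; rewrite ge_min lexx.
Qed.

Lemma gibbs_layer_cake (rho : R) : 0 < rho ->
  measurable_fun setT (fun s : R => (expR (- s) * m (rho * s))%:E) /\
  (\int[lebesgue_rV n]_x (gibbs_weight f rho x)%:E =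
   \int[leb]_(s in `]0%R, +oo[) (expR (- s) * m (rho * s))%:E)%E.
Proof.
move=> rho0.
have mg : measurable_fun setT (fun x => f x / rho).
  by apply: measurable_funM => //; exact: continuous_measurable_rV.
have E s : ((expR (- s))%:E * lebesgue_rV n [set x | f x / rho <= s]%R =
    (expR (- s) * m (rho * s))%:E)%E.
  rewrite EFinM /m fineK ?sublevel_vol_fin//; congr (_ * lebesgue_rV n _)%E.
  by apply/seteqP; split => x /=; rewrite ler_pdivrMr// mulrC.
have [] := integral_expRN_layer_cake (lebesgue_rV n) mg.
under eq_fun do rewrite E.
move=> mE IE.
split => //.
(* The layer-cake integral runs over the whole line: the point 0 is negligible, and for [s < 0] the
   sublevel set is empty because [f >= 0]. *)
rewrite integral_itv_obnd_cbnd; last exact: measurable_funTS.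
rewrite [RHS]integral_mkcond.
transitivity (\int[lebesgue_rV n]_x (expR (- (f x / rho)))%:E)%E.
  by apply: eq_integral => x _; rewrite /gibbs_weight mulNr.
rewrite IE; apply: eq_integral => s _; rewrite patchE.
case: ifPn => //; rewrite notin_setE/= in_itv/= andbT => /negP.
rewrite -ltNge => s0; rewrite /m /sublevel_vol.
rewrite (_ : mkset _ = set0) ?measure0 ?mulr0//.
apply/seteqP; split => // x /=; rewrite leNgt => /negP; apply.
by apply: lt_le_trans (f_ge0 x); rewrite pmulr_rlt0.
Qed.

Lemma gibbs_weight_integrable (rho : R) : 0 < rho ->
  (lebesgue_rV n).-integrable setT (EFin \o gibbs_weight f rho).
Proof.
move=> rho0; apply/integrableP; split; first exact: measurable_gibbs_weight.
under eq_integral do rewrite /= ger0_norm ?expR_ge0//.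
have [mD ->] := gibbs_layer_cake rho0.
(* At this rate the volume of the level [rho * s] grows like [expR (s / 2)], half of what
   [expR (- s)] can absorb. *)
have a0 : 0 < (2 * rho)^-1 by rewrite invr_gt0 mulr_gt0.
have [C C0 CP] := sublevel_vol_le_expR f_cont f_coercive a0.
apply: (@le_lt_trans _ _ (\int[leb]_(s in `]0%R, +oo[) (C%:E * (expR (- 2^-1 * s))%:E))%E).
  apply: ge0_le_integral => //.
  - by move=> s _; rewrite lee_fin mulr_ge0// expR_ge0.
  - exact: measurable_funTS.
  - by apply/measurable_funTS/measurable_funeM; exact: measurable_expRN.
  - move=> s; rewrite /= in_itv/= andbT => s0.
    have rs0 : 0 <= rho * s by rewrite mulr_ge0 ?ltW.
    have := CP _ rs0; rewrite -(fineK (sublevel_vol_fin _ _ (rho * s)))// lee_fin.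
    move=> h; rewrite -EFinM lee_fin.
    apply: (le_trans (ler_wpM2l (expR_ge0 _) h)).
    rewrite mulrCA ler_wpM2l// ?(ltW C0)// -expRD ler_expR.
    rewrite invfM [in leLHS]mulrA mulfVK ?gt_eqF//; lra.
rewrite ge0_integralZl//; last by rewrite lee_fin ltW.
  rewrite integral_itv_obnd_cbnd; last first.
    by apply: measurable_funTS; exact: measurable_expRN.
  by rewrite integral_expRN ?invr_gt0// -EFinM ltry.
by apply: measurable_funTS; exact: measurable_expRN.
Qed.

Lemma gibbs_Z_gt0 (rho : R) : 0 < rho -> 0 < gibbs_Z f rho.
Proof.
move=> rho0; apply: fine_gt0; apply/andP; split; last first.
  have /fineK <- := integrable_fin_num measurableT (gibbs_weight_integrable rho0).
  exact: ltry.
pose A := [set y | f y <= 1].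
have mA : measurable A by exact: measurable_sublevel.
have h1 : (0 < \int[lebesgue_rV n]_(x in A) (expR (- rho^-1))%:E)%E.
  rewrite integral_cst// mule_gt0 ?lte_fin ?expR_gt0//.
  exact: sublevel_vol_gt0.
have h2 : (\int[lebesgue_rV n]_(x in A) (expR (- rho^-1))%:E <=
    \int[lebesgue_rV n]_(x in A) (gibbs_weight f rho x)%:E)%E.
  apply: ge0_le_integral => //.
  - by apply: measurable_funTS; exact: measurable_gibbs_weight.
  - move=> x; rewrite /A/= => fx; rewrite lee_fin ler_expR mulNr lerN2.
    by rewrite ler_pdivrMr// mulVf// gt_eqF.
apply: lt_le_trans h1 (le_trans h2 _).
apply: ge0_subset_integral => //; first exact: measurable_gibbs_weight.
by move=> x _; rewrite lee_fin expR_ge0.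
Qed.


(** Pointwise limit for dominated convergence: dividing by [(u k * s) ^ p] instead of [u k ^ p]
    leaves the factor [s ^ p]. *)
Lemma sublevel_vol_scaled (u : nat -> R) (s : R) : 0 < s ->
  (forall k, 0 < u k) -> u k @[k --> \oo] --> (0 : R) ->
  m (u k * s) / u k `^ p @[k --> \oo] --> V * s `^ p.
Proof.
move=> s0 u0 uc.
have /cvg_at_rightP/(_ (fun k => u k * s)) := sublevel_vol_asymp f_cont f_coercive
  f_min f_uniq f_min0 f_C2 f_posdef.
have us : (forall k, 0 < u k * s) /\ u k * s @[k --> \oo] --> (0 : R).
  split => [k|]; first by rewrite mulr_gt0.
  by rewrite -[X in _ --> X](mul0r s); exact: cvgMr_tmp.
move=> /(_ us) mc.
rewrite (_ : (fun k => _) = (fun k => m (u k * s) / (u k * s) `^ p * s `^ p)).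
  exact: cvgMr_tmp.
apply/funext => k; rewrite powRM ?(ltW s0) ?(ltW (u0 k))// invfM mulrA.
by rewrite divfK// gt_eqF// powR_gt0.
Qed.

(** The dominating rate is [1 - 1/2 - 1/4]: of the decay [expR (- s)], one half absorbs [s ^ p] by
    [powR_le_expR] and one quarter absorbs [expR (u k * s)]. *)
Lemma gibbs_Z_seq (u : nat -> R) : (forall k, 0 < u k <= 4^-1) ->
  u k @[k --> \oo] --> (0 : R) ->
  gibbs_Z f (u k) / u k `^ p @[k --> \oo] --> V * Gamma (p + 1).
Proof.
move=> u01 uc.
have u0 k : 0 < u k by have /andP[] := u01 k.
pose F k (s : R) : \bar R := (expR (- s) * (m (u k * s) / u k `^ p))%:E.
pose l (s : R) : \bar R := (V%:E * (s `^ p * expR (- s))%:E)%E.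
have mF0 k : measurable_fun setT (F k).
  have [+ _] := gibbs_layer_cake (u0 k) => /measurable_EFinP mk.
  apply/measurable_EFinP; rewrite /= (_ : (fun _ => _) =
    (fun s => (expR (- s) * m (u k * s)) * (u k `^ p)^-1)).
    exact: measurable_funM.
  by apply/funext => s; rewrite mulrA.
have IF k : (\int[leb]_(s in `]0%R, +oo[) F k s = (gibbs_Z f (u k) / u k `^ p)%:E)%E.
  have [mk Zk] := gibbs_layer_cake (u0 k).
  have Zfin := integrable_fin_num measurableT (gibbs_weight_integrable (u0 k)).
  rewrite EFinM fineK// [in RHS]muleC Zk -ge0_integralZl//.
  - by apply: eq_integral => s _; rewrite -EFinM /F mulrA mulrC.
  - exact: measurable_funTS.
  - by move=> s _; rewrite lee_fin mulr_ge0// expR_ge0.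
  - by rewrite lee_fin invr_ge0 powR_ge0.
have [C C0 CP] := sublevel_vol_le f_cont f_coercive f_min f_uniq f_min0 f_C2
  f_posdef ltr01.
pose K : R := C * n.+1%:R `^ p.
have K0 : 0 <= K by rewrite mulr_ge0 ?powR_ge0// ltW.
have Fl (s : R) : 0 < s -> F ^~ s @ \oo --> l s.
  move=> s0; rewrite /l -EFinM; apply: cvg_EFin; first exact: nearW.
  rewrite /= (_ : V * _ = expR (- s) * (V * s `^ p)); last by ring.
  by apply: cvgMl_tmp; exact: sublevel_vol_scaled.
have FK k (s : R) : 0 < s -> (`|F k s| <= K%:E * (expR (- 4^-1 * s))%:E)%E.
  move=> s0; have us0 : 0 < u k * s by rewrite mulr_gt0.
  have up0 : 0 < u k `^ p by rewrite powR_gt0.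
  rewrite /F -EFinM lee_fin ger0_norm; last first.
    by rewrite mulr_ge0 ?expR_ge0// divr_ge0// ltW.
  have h1 : m (u k * s) / u k `^ p <= C * s `^ p * expR (4^-1 * s).
    rewrite ler_pdivrMr//; apply: (le_trans (CP _ us0)).
    rewrite mul1r -/p powRM ?(ltW s0) ?(ltW (u0 k))//.
    rewrite (_ : C * (_ * _) * _ = C * s `^ p * expR (u k * s) * u k `^ p); last by ring.
    rewrite ler_wpM2r ?(ltW up0)// ler_wpM2l ?mulr_ge0 ?powR_ge0 ?(ltW C0)//.
    by rewrite ler_expR ler_wpM2r ?(ltW s0)//; have /andP[] := u01 k.
  apply: (le_trans (ler_wpM2l (expR_ge0 _) h1)).
  apply: (@le_trans _ _ (expR (- s) * (C * (n.+1%:R `^ p * expR (s / 2)) * expR (4^-1 * s)))).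
    rewrite ler_wpM2l ?expR_ge0// ler_wpM2r ?expR_ge0// ler_wpM2l ?(ltW C0)//.
    by apply: powR_le_expR; exact: ltW.
  rewrite (_ : expR (- s) * _ = K * (expR (- s) * expR (s / 2) * expR (4^-1 * s))).
    by rewrite -!expRD ler_wpM2l// ler_expR; lra.
  by rewrite /K; ring.
have ml : measurable_fun (`]0%R, +oo[%classic : set (measurableTypeR R)) l.
  apply/measurable_funTS/measurable_funeM/measurable_EFinP.
  exact: measurable_Gamma_integrand.
have aeFl : {ae leb, forall s, `]0%R, +oo[%classic s -> F ^~ s @ \oo --> l s}.
  by apply: aeW => s; rewrite /= in_itv/= andbT; exact: Fl.
have IK : leb.-integrable `]0%R, +oo[
    (fun s => (K%:E * (expR (- 4^-1 * s))%:E)%E).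
  by apply: integrableZl => //; apply: integrable_expRN; lra.
have aeFK : {ae leb, forall s k, `]0%R, +oo[%classic s ->
    (`|F k s| <= K%:E * (expR (- 4^-1 * s))%:E)%E}.
  by apply: aeW => s k; rewrite /= in_itv/= andbT; exact: FK.
have [_ _ Fc] := @dominated_convergence _ (measurableTypeR R) R leb
  `]0%R, +oo[%classic (measurable_itv _) F l
  (fun s => (K%:E * (expR (- 4^-1 * s))%:E)%E)
  (fun k => measurable_funTS (mF0 k)) ml aeFl IK aeFK.
have lE : (\int[leb]_(x in `]0%R, +oo[) l x = (V * Gamma (p + 1))%:E)%E.
  rewrite integralZl//; last exact: integrable_Gamma_half.
  have Gfin := @integrable_fin_num _ (measurableTypeR R) _ leb _ (measurable_itv _) _
    (integrable_Gamma_half n).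
  by rewrite EFinM /Gamma /Rintegral addrK (fineK Gfin).
move: Fc; rewrite lE.
rewrite (_ : [sequence _]_k = EFin \o (fun k => gibbs_Z f (u k) / u k `^ p)).
  by move/fine_cvg.
by apply/funext => k /=; rewrite IF.
Qed.

Lemma gibbs_Z_asymp :
  gibbs_Z f rho / rho `^ p @[rho --> 0^'+] --> V * Gamma (p + 1).
Proof.
apply/cvg_at_rightP => u [u0 uc].
(* Cutting [u] off at 1/4 keeps the limit and makes the domination by a multiple
   of [expR (- s / 4)] uniform in the index. *)
pose v k := Order.min (u k) 4^-1.
have uv : \forall k \near \oo, v k = u k.
  have [N _ NP] : \forall k \near \oo, `|0 - u k| < 4^-1.
    by have /cvgrPdist_lt := uc; apply; lra.
  exists N => // k Nk; rewrite /v min_l//.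
  by have := NP k Nk; rewrite /= sub0r normrN gtr0_norm//; exact: ltW.
have vc : v k @[k --> \oo] --> (0 : R).
  by apply: cvg_trans uc; apply: near_eq_cvg; apply: filterS uv => k ->.
have /gibbs_Z_seq/(_ vc) : forall k, 0 < v k <= 4^-1.
  by move=> k; rewrite lt_min u0 ge_min lexx orbT !andbT; lra.
apply: cvg_trans; apply: near_eq_cvg.
by apply: filterS uv => k ->.
Qed.

(** * The distribution function near zero and its constant *)

Lemma gibbs_cdf_bounds (rho x : R) : 0 < rho ->
  expR (- x / rho) * m x <= gibbs_Z f rho * gibbs_cdf f rho x <= m x.
Proof.
move=> rho0; have Z0 := gibbs_Z_gt0 rho0.
rewrite /gibbs_cdf mulrA mulfV ?gt_eqF// mul1r.
pose A := [set y | f y <= x].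
have mA : measurable A by exact: measurable_sublevel.
have mw : measurable_fun A (EFin \o gibbs_weight f rho).
  by apply: measurable_funTS; exact: measurable_gibbs_weight.
have Ifin : (\int[lebesgue_rV n]_(y in A) (gibbs_weight f rho y)%:E)%E \is a fin_num.
  apply: integrable_fin_num => //.
  by apply: integrableS (gibbs_weight_integrable rho0).
have mfin := sublevel_vol_fin f_cont f_coercive x.
rewrite -!lee_fin EFinM /Rintegral !fineK//.
apply/andP; split.
  rewrite -[X in (_ * X)%E]/(lebesgue_rV n A) -integral_cst//.
  apply: ge0_le_integral => //; first by move=> y _; rewrite lee_fin expR_ge0.
  move=> y; rewrite /A/= => fy; rewrite lee_fin ler_expR.
  by rewrite ler_wpM2r ?invr_ge0 ?(ltW rho0)// lerN2.
rewrite -[leRHS]/(lebesgue_rV n A) -[leRHS]mul1e -integral_cst//.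
apply: ge0_le_integral => //.
- by move=> y _; rewrite lee_fin expR_ge0.
- move=> y _; rewrite lee_fin -expR0 ler_expR mulNr oppr_le0.
  by rewrite divr_ge0// ltW.
Qed.

Lemma gibbs_cdf_asymp (rho : R) : 0 < rho ->
  gibbs_cdf f rho x / (V / gibbs_Z f rho * x `^ p) @[x --> 0^'+] --> (1 : R).
Proof.
move=> rho0; have Z0 := gibbs_Z_gt0 rho0.
have V0 : 0 < V by exact: quad_vol_gt0.
have mV : m x / x `^ p / V @[x --> 0^'+] --> (1 : R).
  rewrite -[X in _ --> X](@mulfV _ V) ?gt_eqF//; apply: cvgMr_tmp.
  exact: (sublevel_vol_asymp f_cont f_coercive f_min f_uniq f_min0 f_C2 f_posdef).
have ec : expR (- x / rho) @[x --> (0 : R)^'+] --> (1 : R).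
  rewrite -[X in _ --> X]expR0 -[X in expR X](mul0r rho^-1) -[X in X / _]oppr0.
  apply: continuous_cvg; first exact: continuous_expR.
  by apply: cvgMr_tmp; apply: cvgN; exact: cvg_at_right_filter cvg_id.
apply: (squeeze_cvgr _ _ mV).
2: by rewrite -[X in _ --> X]mul1r; exact: (cvgM ec mV).
near=> x.
have x0 : 0 < x by [].
have xp : 0 < x `^ p by exact: powR_gt0.
have := gibbs_cdf_bounds x rho0.
have -> : gibbs_cdf f rho x / (V / gibbs_Z f rho * x `^ p) =
    gibbs_Z f rho * gibbs_cdf f rho x / x `^ p / V.
  by rewrite !invfM invrK; ring.
move=> /andP[h1 h2] /=; apply/andP; split; last first.
  by rewrite !ler_wpM2r ?invr_ge0// ltW.
rewrite [leLHS](_ : _ = expR (- x / rho) * m x / x `^ p / V); last by ring.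
by rewrite !ler_wpM2r ?invr_ge0// ltW.
Unshelve. all: by end_near. Qed.

Lemma gibbs_constant_asymp :
  V / gibbs_Z f rho / (1 / (Gamma (p + 1) * rho `^ p)) @[rho --> 0^'+] --> (1 : R).
Proof.
have V0 : 0 < V by exact: quad_vol_gt0.
have G0 : 0 < Gamma (p + 1) by exact: Gamma_half_gt0.
have VG0 : V * Gamma (p + 1) != 0 by rewrite gt_eqF// mulr_gt0.
rewrite (_ : (fun rho => _) =
  (fun rho => V * Gamma (p + 1) * (gibbs_Z f rho / rho `^ p)^-1)); last first.
  by apply/funext => rho; rewrite mul1r invrK invfM invrK; ring.
rewrite -[X in _ --> X](mulfV VG0); apply: cvgMl_tmp.
by apply: cvgV => //; exact: gibbs_Z_asymp.
Qed.

(** [gibbs] uses the extended-real integral and [gibbs_cdf] its real part; integrability of the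
    weight makes them agree. *)
Lemma gibbs_sublevel (rho x : R) : 0 < rho ->
  gibbs f rho [set y | f y <= x] = (gibbs_cdf f rho x)%:E.
Proof.
move=> rho0; rewrite /gibbs /gibbs_cdf EFinM /Rintegral fineK//.
apply: integrable_fin_num; first exact: measurable_sublevel.
apply: integrableS (gibbs_weight_integrable rho0) => //.
exact: measurable_sublevel.
Qed.

End gibbs_normalization.

Theorem proposition2p3 (R : realType) (n : nat) (f : 'rV[R]_n -> R)
    (xstar : 'rV[R]_n) :
  (0 < n)%N ->
  assumptionA f ->
  is_minimizer f xstar -> (forall x, is_minimizer f x -> x = xstar) ->
  f xstar = 0 ->
  posdef (hess f xstar) ->
  (forall rho : R, 0 < rho ->
   forall (d : measure_display) (T : measurableType d) (P : probability T R)
     (X : nat -> {RV P >-> 'rV[R]_n}),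
     iid_with_law (gibbs f rho) X ->
     exists G : nat -> {RV P >-> R},
       (forall i w, G i w = f (X i w)) /\
       (forall i x, cdf (G i) x = (gibbs_cdf f rho x)%:E)) /\
  exists c : R -> R,
    (forall rho : R, 0 < rho ->
       asymp 0^'+ (gibbs_cdf f rho) (fun x => c rho * x `^ (n%:R / 2))) /\
    asymp 0^'+ c
      (fun rho => 1 / (Gamma (n%:R / 2 + 1) * rho `^ (n%:R / 2))).
Proof.
move=> _ [fC2 [fcoer _ _] _] fmin funiq fmin0 fpos.
have fcont : continuous f by apply: has_continuous_partials_continuous; case: fC2.
split.
  move=> rho rho0 d T P X [_ Xlaw].
  have mG i : measurable_fun setT (f \o X i).
    by apply: measurableT_comp => //; exact: continuous_measurable_rV.
  pose G i : {RV P >-> R} :=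
    HB.pack (f \o X i) (isMeasurableFun.Build _ _ _ _ _ (mG i)).
  exists G; split => // i x.
  (* The event that [G i] is at most [x] is the preimage under [X i] of a sublevel set of [f], so
     its probability is read off the law of [X i]. *)
  rewrite -(gibbs_sublevel fcont fcoer fmin fmin0)//.
  rewrite -(Xlaw i)//; exact: measurable_sublevel.
exists (fun rho => quad_vol (hess f xstar) / gibbs_Z f rho); split.
  by move=> rho rho0; exact: gibbs_cdf_asymp.
exact: gibbs_constant_asymp.
Qed.
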